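(* Let $I\subseteq\mathbb{R}$ be a nonempty interval and let $f:I\to\mathbb{R}$ be operator convex. For all $A,B\in\mathcal{S}_I(H)$, $$f\big(A\nabla B\big)\le\int_0^1 f\big(A\nabla_t B\big)\,dt\le\int_0^1\int_0^1 f\big(A\nabla_t B\big)\,d\eta_\lambda(t)\,d\lambda\le f(A)\nabla f(B).$$ If $f$ is operator concave, all the inequalities are reversed.
   Context: $H$ is a complex Hilbert space, $\mathcal{B}(H)$ the bounded linear operators on $H$. For self-adjoint operators, $A\le B$ means that $B-A$ is positive. For an interval $I$, $\mathcal{S}_I(H)$ is the set of self-adjoint operators in $\mathcal{B}(H)$ with spectrum contained in $I$; for $f:I\to\mathbb{R}$ (continuous) and $A\in\mathcal{S}_I(H)$, $f(A)$ is defined by the continuous functional calculus. $f$ is operator convex (resp. concave) on $I$ if $f((1-\lambda)A+\lambda B)\le$ (resp. $\ge$) $(1-\lambda)f(A)+\lambda f(B)$ for all $A,B\in\mathcal{S}_I(H)$, $\lambda\in[0,1]$. For $X,Y\in\mathcal{B}(H)$ and $\lambda\in[0,1]$, $X\nabla_\lambda Y:=(1-\lambda)X+\lambda Y$ and $X\nabla Y:=X\nabla_{1/2}Y$. For $\lambda\in(0,1)$, $\eta_\lambda$ is the probability measure on $[0,1]$ given by $d\eta_\lambda(t)=\frac{\lambda}{1-\lambda}\,t^{\frac{2\lambda-1}{1-\lambda}}\,dt$. Integrals of operator-valued functions are taken in the norm (Bochner) sense. *)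

(* Defs.v *)
From HB Require Import structures.
From mathcomp Require Import all_boot all_order all_algebra.
From mathcomp Require Import complex.
From mathcomp Require Import all_classical all_reals all_analysis.
From mathcomp Require Import measurable_realfun.

Set Implicit Arguments.
Unset Strict Implicit.
Unset Printing Implicit Defensive.

Import Order.TTheory GRing.Theory Num.Theory.
Import numFieldNormedType.Exports.

Local Open Scope classical_set_scope.
Local Open Scope ring_scope.
Local Open Scope complex_scope.

(* The inner product is linear in its first argument. *)
HB.mixin Record isInnerProduct (R : realType) H
    of CompleteNormedModule R[i] H := {
  inner : H -> H -> R[i] ;
  innerDl : forall x y z, inner (x + y) z = inner x z + inner y z ;
  innerZl : forall (a : R[i]) x y, inner (a *: x) y = a * inner x y ;
  inner_conj : forall x y, inner y x = (inner x y)^* ;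
  inner_norm : forall x, inner x x = `|x| ^+ 2
}.

#[short(type="hilbertType")]
HB.structure Definition Hilbert (R : realType) :=
  {H of isInnerProduct R H & CompleteNormedModule R[i] H}.

Section real_norm.
Context (R : realType).

Lemma rcD (x y : R) : (x + y)%:C = x%:C + y%:C :> R[i].
Proof. exact: rmorphD. Qed.

Lemma rcM (x y : R) : (x * y)%:C = x%:C * y%:C :> R[i].
Proof. exact: rmorphM. Qed.

Lemma normcE (a : R[i]) : `|a| = (complex.Re `|a|)%:C.
Proof. by rewrite RRe_real// ger0_real. Qed.

Lemma Re_norm_ge0 (a : R[i]) : 0 <= complex.Re `|a|.
Proof. by rewrite -lecR -normcE normr_ge0. Qed.

Context (V : normedModType R[i]).

(* In a normedModType over R[i] the norm takes its (real) values in R[i]. *)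
Definition rnorm (v : V) : R := complex.Re `|v|.

Lemma rnormE (v : V) : `|v| = (rnorm v)%:C.
Proof. by rewrite /rnorm RRe_real// ger0_real. Qed.

Lemma rnorm_ge0 (v : V) : 0 <= rnorm v.
Proof. by rewrite -lecR -rnormE normr_ge0. Qed.

Lemma rnormZ (a : R[i]) (v : V) : rnorm (a *: v) = complex.Re `|a| * rnorm v.
Proof. by apply: (@complexI R); rewrite rcM -!rnormE -normcE normrZ. Qed.

Lemma rnormD (v w : V) : rnorm (v + w) <= rnorm v + rnorm w.
Proof. by rewrite -lecR rcD -!rnormE ler_normD. Qed.

Lemma rnorm0 : rnorm (0 : V) = 0.
Proof. by rewrite /rnorm normr0. Qed.

End real_norm.

Section bounded_operators.
Context (R : realType) (H : hilbertType R).

Definition is_bounded_op : {pred H -> H} := fun f =>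
  `[< (forall (a : R[i]) x y, f (a *: x + y) = a *: f x + f y) /\
      (exists M : R, forall x, `|f x| <= M%:C * `|x|) >].

Record bop := Bop { bop_fun :> H -> H ; bopP : bop_fun \in is_bounded_op }.

HB.instance Definition _ := [isSub for bop_fun].
HB.instance Definition _ := [Choice of bop by <:].

Fact is_bounded_op_submod : submod_closed is_bounded_op.
Proof.
split.
  rewrite unfold_in; apply/asboolP; split.
    by move=> a x y; rewrite -[LHS]/0 -[RHS]/(a *: 0 + 0) scaler0 addr0.
  by exists 0 => x; rewrite -[X in `|X|]/0 normr0 mul0r.
move=> a f g /asboolP[fL [M fM]] /asboolP[gL [N gN]]; apply/asboolP; split.
  move=> b x y; rewrite -[LHS]/(a *: f _ + g _) fL gL.
  rewrite -[RHS]/(b *: (a *: f x + g x) + (a *: f y + g y)).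
  by rewrite !scalerDr !scalerA (mulrC a b) addrACA.
exists (complex.Re `|a| * M + N) => x; rewrite -[X in `|X|]/(a *: f x + g x).
rewrite rcD rcM -normcE mulrDl.
apply: le_trans (ler_normD _ _) _; apply: lerD; last exact: gN.
by rewrite normrZ -mulrA; apply: ler_wpM2l.
Qed.
HB.instance Definition _ :=
  GRing.isSubmodClosed.Build _ _ is_bounded_op is_bounded_op_submod.
HB.instance Definition _ := [SubChoice_isSubLmodule of bop by <:].


Lemma bop_linear (A : bop) (a : R[i]) x y : A (a *: x + y) = a *: A x + A y.
Proof. by have /asboolP[AL _] := bopP A. Qed.

Lemma bop_bounded (A : bop) : exists M : R, forall x, `|A x| <= M%:C * `|x|.
Proof. by have /asboolP[_] := bopP A. Qed.

Lemma bopE (A B : bop) : (forall x, A x = B x) -> A = B.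
Proof. by move=> AB; apply/val_inj/funext. Qed.

Lemma bopDE (A B : bop) x : (A + B) x = A x + B x. Proof. by []. Qed.
Lemma bopZE (a : R[i]) (A : bop) x : (a *: A) x = a *: A x. Proof. by []. Qed.
Lemma bop0E x : (0 : bop) x = 0. Proof. by []. Qed.

Lemma bopD (A : bop) x y : A (x + y) = A x + A y.
Proof. by have := bop_linear A 1 x y; rewrite !scale1r. Qed.

Lemma bop0 (A : bop) : A 0 = 0.
Proof. by apply: (@addrI _ (A 0)); rewrite -bopD !addr0. Qed.

Lemma bopZ (A : bop) (a : R[i]) x : A (a *: x) = a *: A x.
Proof. by rewrite -[a *: x]addr0 bop_linear bop0 addr0. Qed.

Fact bop_id_subproof : (@id H) \in is_bounded_op.
Proof. by apply/asboolP; split => //; exists 1 => x; rewrite mul1r. Qed.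
Definition bop_id : bop := Bop bop_id_subproof.

Fact bop_comp_subproof (A B : bop) : (A \o B) \in is_bounded_op.
Proof.
apply/asboolP; split => [a x y|/=]; first by rewrite /= !bop_linear.
have [M AM] := bop_bounded A; have [N BN] := bop_bounded B.
exists (`|M| * N) => x; apply: le_trans (AM _) _.
rewrite rcM -mulrA; apply: (@le_trans _ _ (`|M|%:C * `|B x|)).
  by apply: ler_wpM2r => //; rewrite lecR ler_norm.
by apply: ler_wpM2l; rewrite ?ler0c.
Qed.
Definition bop_comp (A B : bop) : bop := Bop (bop_comp_subproof A B).

Fact bop_compA : associative bop_comp. Proof. by move=> A B C; exact: bopE. Qed.
Fact bop_comp1l : left_id bop_id bop_comp. Proof. by move=> A; exact: bopE. Qed.
Fact bop_comp1r : right_id bop_id bop_comp. Proof. by move=> A; exact: bopE. Qed.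
Fact bop_compDl : left_distributive bop_comp +%R.
Proof. by move=> A B C; exact: bopE. Qed.
Fact bop_compDr : right_distributive bop_comp +%R.
Proof. by move=> A B C; apply: bopE => x; exact: bopD. Qed.

(* The zero space is allowed, so this ring may be trivial, hence no algType. *)
HB.instance Definition _ := GRing.Zmodule_isPzRing.Build bop
  bop_compA bop_comp1l bop_comp1r bop_compDl bop_compDr.

Lemma bop_scaleAl (a : R[i]) (A B : bop) : a *: (A * B) = (a *: A) * B.
Proof. exact: bopE. Qed.

Lemma bop_scaleAr (a : R[i]) (A B : bop) : a *: (A * B) = A * (a *: B).
Proof. by apply: bopE => x; symmetry; exact: bopZ. Qed.

Definition opnorm (A : bop) : R :=
  sup [set rnorm (A x) | x in [set x | rnorm x <= 1]].

Let ball_image (A : bop) := [set rnorm (A x) | x in [set x | rnorm x <= 1]].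

Let ball_image0 A : ball_image A 0.
Proof. by exists 0; rewrite /= ?bop0 rnorm0// ler01. Qed.

Lemma has_sup_opnorm (A : bop) : has_sup (ball_image A).
Proof.
split; first by exists 0; exact: ball_image0.
have [M AM] := bop_bounded A; exists `|M| => _ [x /= x1 <-].
have := AM x; rewrite !rnormE -rcM lecR => /le_trans; apply.
rewrite (le_trans (ler_norm _))// normrM (ger0_norm (rnorm_ge0 _)).
by rewrite ler_piMr.
Qed.

Lemma opnorm_ge0 (A : bop) : 0 <= opnorm A.
Proof. by apply: sup_upper_bound (ball_image0 A); exact: has_sup_opnorm. Qed.

Lemma le_opnorm (A : bop) x : rnorm (A x) <= opnorm A * rnorm x.
Proof.
have [->|x0] := eqVneq x 0; first by rewrite bop0 rnorm0 mulr0.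
have nx0 : 0 < rnorm x by rewrite -ltcR -rnormE normr_gt0.
have cE : complex.Re `|(rnorm x)^-1%:C| = (rnorm x)^-1.
  by apply: (@complexI R); rewrite -normcE ger0_norm// ler0c invr_ge0 ltW.
rewrite -ler_pdivrMr// mulrC.
suff -> : (rnorm x)^-1 * rnorm (A x) = rnorm (A ((rnorm x)^-1%:C *: x)).
  apply: sup_upper_bound; first exact: has_sup_opnorm.
  exists ((rnorm x)^-1%:C *: x) => //=.
  by rewrite rnormZ cE mulVf// gt_eqF.
by rewrite bopZ rnormZ cE.
Qed.

Lemma opnorm_le (A : bop) (M : R) : 0 <= M ->
  (forall x, rnorm (A x) <= M * rnorm x) -> opnorm A <= M.
Proof.
move=> M0 AM; apply: ge_sup; first by exists 0; exact: ball_image0.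
by move=> _ [x /= x1 <-]; rewrite (le_trans (AM x))// ler_piMr.
Qed.

Let bnorm (A : bop) : R[i] := (opnorm A)%:C.

Fact bnormD (A B : bop) : bnorm (A + B) <= bnorm A + bnorm B.
Proof.
rewrite /bnorm -rcD lecR; apply: opnorm_le.
  by rewrite addr_ge0 ?opnorm_ge0.
move=> x; rewrite bopDE mulrDl (le_trans (rnormD _ _))//.
by rewrite lerD ?le_opnorm.
Qed.

Let opnormZ_le (a : R[i]) (A : bop) : opnorm (a *: A) <= complex.Re `|a| * opnorm A.
Proof.
apply: opnorm_le; first by rewrite mulr_ge0 ?opnorm_ge0 ?Re_norm_ge0.
by move=> x; rewrite bopZE rnormZ -mulrA ler_wpM2l ?le_opnorm ?Re_norm_ge0.
Qed.

Fact bnormZ (a : R[i]) (A : bop) : bnorm (a *: A) = `|a| * bnorm A.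
Proof.
rewrite /bnorm normcE -rcM; congr (_%:C).
apply/eqP; rewrite eq_le opnormZ_le andTb.
have [->|a0] := eqVneq a 0; first by rewrite normr0 mul0r opnorm_ge0.
have := opnormZ_le a^-1 (a *: A); rewrite scalerA mulVf// scale1r.
have an0 : 0 < complex.Re `|a| by rewrite -ltcR -normcE normr_gt0.
rewrite -(ler_pM2l an0) => /le_trans; apply.
suff -> : complex.Re `|a| * (complex.Re `|a^-1| * opnorm (a *: A)) =
    opnorm (a *: A) by [].
rewrite mulrA [X in X * _](_ : _ = 1) ?mul1r//; apply: (@complexI R).
by rewrite rcM -!normcE -normrM mulfV// normr1.
Qed.

Fact bnorm_eq0 (A : bop) : bnorm A = 0 -> A = 0.
Proof.
move=> /(@complexI R) A0; apply: bopE => x; apply/eqP.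
rewrite bop0E -normr_eq0 rnormE -[0]/(0%:C) (inj_eq (@complexI R)) eq_le.
by rewrite rnorm_ge0 andbT (le_trans (le_opnorm _ _))// A0 mul0r.
Qed.

HB.instance Definition _ :=
  Lmodule_isNormed.Build R[i] bop bnormD bnormZ bnorm_eq0.

End bounded_operators.

Section operators.
Context (R : realType) (H : hilbertType R).
Implicit Types (A B X Y T : bop H) (I : set R) (f : R -> R).

Definition selfadjoint A := forall x y, inner (A x) y = inner x (A y).

Definition positive_op T := forall x, 0 <= inner (T x) x.

Definition ople A B := positive_op (B - A).

Definition invertible T := exists S : bop H, S * T = 1 /\ T * S = 1.

Definition spectrum A : set R[i] :=
  [set z : R[i] | ~ invertible (A - z *: (1 : bop H))].

Definition sa_in I A := selfadjoint A /\ spectrum A `<=` [set x%:C | x in I].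

Definition poly_op (p : {poly R}) A : bop H :=
  \sum_(i < size p) (p`_i)%:C *: A ^+ i.

(* X is the norm limit of p_n(A), for real polynomials p_n converging to f
   uniformly on the spectrum of A. *)
Definition is_cfc f A X := exists p : nat -> {poly R},
  (forall e : R, 0 < e -> \forall n \near \oo,
     forall x : R, spectrum A x%:C -> `|(p n).[x] - f x| < e) /\
  poly_op (p n) A @[n --> \oo] --> X.

(* The limit exists and is unique when A is self-adjoint and f is continuous on
   its spectrum; 0 is a default value. *)
Definition cfc f A : bop H := xget 0 [set X | is_cfc f A X].

Definition nabla (t : R) X Y : bop H := (1 - t)%:C *: X + t%:C *: Y.

Definition operator_convex I f := forall A B, sa_in I A -> sa_in I B ->
  forall l : R, 0 <= l <= 1 ->
  ople (cfc f (nabla l A B)) (nabla l (cfc f A) (cfc f B)).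

Definition operator_concave I f := forall A B, sa_in I A -> sa_in I B ->
  forall l : R, 0 <= l <= 1 ->
  ople (nabla l (cfc f A) (cfc f B)) (cfc f (nabla l A B)).

End operators.

Section bochner.
Context (d : measure_display) (T : measurableType d) (R : realType).
Context (V : normedModType R[i]).
Variables (mu : {measure set T -> \bar R}) (D : set T).
Implicit Types (F s : T -> V) (X : V).

Definition simple_integrable s :=
  [/\ finite_set (range s),
      forall v, measurable (s @^-1` [set v]) &
      forall v, v != 0 -> (mu (D `&` s @^-1` [set v]) < +oo)%E].

Definition simple_integral s : V :=
  \sum_(v \in range s) (fine (mu (D `&` s @^-1` [set v])))%:C *: v.

Definition is_bochner F X := exists s : nat -> T -> V,
  [/\ forall n, simple_integrable (s n),
      {ae mu, forall x, D x -> s n x @[n --> \oo] --> F x},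
      (\int[mu]_(x in D) (rnorm (F x - s n x))%:E @[n --> \oo] --> 0)%E &
      simple_integral (s n) @[n --> \oo] --> X].

(* 0 is the default value when F is not Bochner integrable over D. *)
Definition bochner F : V := xget 0 [set X | is_bochner F X].

End bochner.

Section eta.
Context (R : realType) (l : R).
Local Notation mu := (@lebesgue_measure R).

(* Set to 0 for l outside ]0, 1[, so that eta_measure l is a measure for all l. *)
Definition eta_pdf (t : R) : R :=
  if (0 < l < 1) && (0 <= t <= 1)
  then l / (1 - l) * t `^ ((2 * l - 1) / (1 - l)) else 0.

Lemma eta_pdf_ge0 t : 0 <= eta_pdf t.
Proof.
rewrite /eta_pdf; case: ifPn => // /andP[/andP[l0 l1] _].
by rewrite mulr_ge0 ?powR_ge0// divr_ge0 ?subr_ge0// ltW.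
Qed.

Lemma measurable_eta_pdf : measurable_fun setT eta_pdf.
Proof.
rewrite /eta_pdf /=; apply: measurable_fun_if => //=.
  by do 2 apply: measurable_and => //; exact: measurable_fun_ler.
apply: measurable_funM => //.
by apply: measurable_funTS; exact: measurable_powR.
Qed.

Definition eta_measure (U : set (measurableTypeR R)) : \bar R :=
  (\int[mu]_(t in U) (eta_pdf t)%:E)%E.

Let eta0 : eta_measure set0 = 0%E.
Proof. by rewrite /eta_measure integral_set0. Qed.

Let eta_ge0 U : (0 <= eta_measure U)%E.
Proof. by apply: integral_ge0 => /= x Ux; rewrite lee_fin eta_pdf_ge0. Qed.

Let eta_sigma_additive : semi_sigma_additive eta_measure.
Proof.
move=> /= F mF tF mUF; rewrite /eta_measure; apply: cvg_toP.
  apply: ereal_nondecreasing_is_cvgn => m n mn.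
  apply: lee_sum_nneg_natr => // k _ _.
  by apply: integral_ge0 => /= x Fkx; rewrite lee_fin eta_pdf_ge0.
rewrite ge0_integral_bigcup//=.
- apply: measurable_funTS; apply: measurableT_comp => //.
  exact: measurable_eta_pdf.
- by move=> x _; rewrite lee_fin eta_pdf_ge0.
Qed.

HB.instance Definition _ := isMeasure.Build _ _ _ eta_measure
  eta0 eta_ge0 eta_sigma_additive.

End eta.

(* Main.v *)
(* For A, B with spectrum in I put F(t) = f(A nabla_t B) on [0, 1]. Norm and spectral
   radius of a self-adjoint operator agree, so the continuous functional calculus
   exists (polynomials are dense by Weierstrass' theorem), F is norm continuous,
   and A nabla_t B keeps its spectrum in the convex hull of those of A and B.
   The Bochner integrals of F and of l |-> int F d eta_l therefore exist, and they
   commute with the functionals X |-> Re <X x, y>. For fixed x the function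
   phi(t) = <F(t) x, x> is convex and eta_l is a probability with mean l, so that
   phi(l) <= int phi d eta_l <= (1 - l) phi(0) + l phi(1): a supporting line at l
   gives the first inequality, the chord the second one. Integrating over l gives
   the last two inequalities of the statement; the first one is the case l = 1/2,
   where eta_l is the Lebesgue measure. *)
Require Import Defs.
From HB Require Import structures.
From mathcomp Require Import all_boot all_order all_algebra.
From mathcomp Require Import complex.
From mathcomp Require Import all_classical all_reals all_analysis.
From mathcomp Require Import measurable_realfun finmap ring lra.

Set Implicit Arguments.
Unset Strict Implicit.
Unset Printing Implicit Defensive.

Import Order.TTheory GRing.Theory Num.Theory.
Import numFieldNormedType.Exports.

Local Open Scope classical_set_scope.
Local Open Scope ring_scope.
Local Open Scope complex_scope.


(** The spectral theory rests on one elementary fact: for self-adjoint [T] with [n = |T|],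
    [T^2 - n^2] is not invertible. Splitting [p^2 - n^2] into linear factors over [R[i]] turns this
    into the bound of [|p(A)|] by the supremum of [|p|] on the spectrum, and the factors [T - n] and
    [T + n] locate the extreme points of the spectrum; neither the resolvent as a holomorphic
    function nor Gelfand's formula enters.

    The obstacle on the measure side is that the algebra of operators need not be separable, so weak
    measurability does not yield simple approximants. They are built by sampling a norm continuous
    map at simple functions of its parameter. The outer integrand must therefore be norm continuous
    in [l], which follows from the continuity of [l |-> eta_pdf l] in [L^1]; towards the ends of
    []0, 1[] the mass of [eta_l] concentrates at 0 and at 1, hence the open interval. *)

Section rnorm_theory.
Context (R : realType) (V : normedModType R[i]).
Implicit Types v w : V.

Lemma rnormN v : rnorm (- v) = rnorm v.
Proof. by rewrite /rnorm normrN. Qed.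

Lemma rnormBC v w : rnorm (v - w) = rnorm (w - v).
Proof. by rewrite /rnorm distrC. Qed.

Lemma rnormB_le v w z : rnorm (v - w) <= rnorm (v - z) + rnorm (z - w).
Proof. by rewrite (le_trans _ (rnormD _ _))// addrA subrK. Qed.

Lemma rnorm_eq0 v : rnorm v = 0 -> v = 0.
Proof. by move=> v0; apply/eqP; rewrite -normr_eq0 rnormE v0. Qed.

Lemma Re_normc (a : R) : complex.Re `|a%:C| = `|a|.
Proof. by rewrite normc_def/= expr0n/= addr0 sqrtr_sqr. Qed.

Lemma rnormZr (a : R) v : rnorm (a%:C *: v) = `|a| * rnorm v.
Proof. by rewrite rnormZ Re_normc. Qed.

Lemma rnorm_cvgP (u : nat -> V) v :
  u n @[n --> \oo] --> v <-> rnorm (u n - v) @[n --> \oo] --> (0 : R).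
Proof.
split.
  move=> /cvgrPdist_lt uv; apply/cvgrPdist_lt => e e0.
  have /uv : 0 < e%:C by rewrite ltcR.
  apply: filterS => n; rewrite rnormE ltcR rnormBC.
  by rewrite sub0r normrN ger0_norm// rnorm_ge0.
move=> /cvgrPdist_lt uv; apply/cvgrPdist_lt => e e0.
(* Convergence in [V] quantifies over positive [e] in [R[i]]; positivity in that order forces [e] to
   be real. *)
have eE : e = (complex.Re e)%:C by rewrite RRe_real// gtr0_real.
have /uv : 0 < complex.Re e by rewrite -ltcR -eE.
apply: filterS => n; rewrite rnormE {2}eE ltcR rnormBC.
by rewrite sub0r normrN ger0_norm// rnorm_ge0.
Qed.

Lemma rnorm_squeeze (u : nat -> V) v (e : nat -> R) :
  (forall n, rnorm (u n - v) <= e n) -> e n @[n --> \oo] --> (0 : R) ->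
  u n @[n --> \oo] --> v.
Proof.
move=> ue e0; apply/rnorm_cvgP.
apply: (@squeeze_cvgr _ _ _ _ (cst 0) e) => //; last exact: cvg_cst.
by apply: nearW => n; rewrite rnorm_ge0 ue.
Qed.

Lemma rnorm_lim_le (u : nat -> V) v (M : R) :
  u n @[n --> \oo] --> v -> (\forall n \near \oo, rnorm (u n) <= M) ->
  rnorm v <= M.
Proof.
move=> /rnorm_cvgP uv uM; apply/ler_addgt0Pr => e e0.
have /cvgrPdist_lt/(_ _ e0) ue := uv.
near \oo => n.
have h : `|0 - rnorm (u n - v)| < e by near: n; exact: ue.
have h2 : rnorm (u n) <= M by near: n; exact: uM.
rewrite sub0r normrN ger0_norm ?rnorm_ge0// in h.
rewrite -[v](subrK (u n)) (le_trans (rnormD _ _))// addrC lerD//.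
by rewrite rnormBC ltW.
Unshelve. all: by end_near. Qed.

End rnorm_theory.

Section rnorm_complete.
Context (R : realType) (V : completeNormedModType R[i]).

Lemma rnorm_cauchy_cvg (u : nat -> V) :
  (forall e : R, 0 < e -> exists N, forall m n, (N <= m)%N -> (N <= n)%N ->
     rnorm (u m - u n) <= e) -> exists v : V, u n @[n --> \oo] --> v.
Proof.
move=> cu; apply/cvg_ex/cauchy_cvgP/cauchyP => e e0.
have eE : e = (complex.Re e)%:C by rewrite RRe_real// gtr0_real.
have re0 : 0 < complex.Re e / 2 by rewrite divr_gt0// -ltcR -eE.
have [N uN] := cu _ re0.
exists (u N); exists N => // n /= Nn; rewrite -ball_normE /= rnormE eE ltcR.
by rewrite (le_lt_trans (uN _ _ _ Nn))// ltr_pdivrMr// ltr_pMr ?ltr1n// -ltcR -eE.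
Qed.

End rnorm_complete.

(** * The real part of the inner product *)

Section hilbert.
Context (R : realType) (H : hilbertType R).
Implicit Types x y z : H.

Definition rip x y : R := complex.Re (inner x y).

Lemma ripDl x y z : rip (x + y) z = rip x z + rip y z.
Proof. by rewrite /rip innerDl raddfD. Qed.

Lemma ripZl (a : R) x y : rip (a%:C *: x) y = a * rip x y.
Proof. by rewrite /rip innerZl; case: (inner x y) => b c /=; rewrite mul0r subr0. Qed.

Lemma ripC x y : rip x y = rip y x.
Proof. by rewrite /rip (inner_conj y x); case: (inner y x). Qed.

Lemma ripNl x y : rip (- x) y = - rip x y.
Proof. by rewrite -scaleN1r -[-1](rmorphN1 (real_complex R)) ripZl mulN1r. Qed.

Lemma ripBl x y z : rip (x - y) z = rip x z - rip y z.
Proof. by rewrite ripDl ripNl. Qed.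

Lemma ripDr x y z : rip x (y + z) = rip x y + rip x z.
Proof. by rewrite ripC ripDl !(ripC x). Qed.

Lemma ripZr (a : R) x y : rip x (a%:C *: y) = a * rip x y.
Proof. by rewrite ripC ripZl ripC. Qed.

Lemma ripNr x y : rip x (- y) = - rip x y.
Proof. by rewrite ripC ripNl ripC. Qed.

Lemma ripBr x y z : rip x (y - z) = rip x y - rip x z.
Proof. by rewrite ripDr ripNr. Qed.

Lemma rip_rnorm x : rip x x = rnorm x ^+ 2.
Proof.
by rewrite /rip inner_norm rnormE -rmorphXn.
Qed.

(* Cauchy-Schwarz is read off the triangle inequality, already available. *)
Lemma rip_le x y : `|rip x y| <= rnorm x * rnorm y.
Proof.
have h z : rip z y <= rnorm z * rnorm y.
  have : rnorm (z + y) ^+ 2 <= (rnorm z + rnorm y) ^+ 2.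
    by rewrite ler_sqr ?nnegrE ?addr_ge0 ?rnorm_ge0// rnormD.
  rewrite -!rip_rnorm !(ripDl, ripDr) !rip_rnorm (ripC y z) => ?; nra.
by rewrite ler_norml h andbT lerNl -ripNl -(rnormN x) h.
Qed.

Lemma Im_inner x y : complex.Im (inner x y) = rip x ('i *: y).
Proof.
rewrite ripC /rip innerZl (inner_conj y x).
by case: (inner y x) => a b /=; rewrite mul0r mul1r sub0r.
Qed.

(** Pairing with ['i *: y] recovers the imaginary part, so self-adjointness can be tested on [rip]
    alone. *)
Lemma innerP x y x' y' : rip x y = rip x' y' ->
  rip x ('i *: y) = rip x' ('i *: y') -> inner x y = inner x' y'.
Proof.
rewrite -!Im_inner /rip.
by case: (inner x y) => a b; case: (inner x' y') => c d /= -> ->.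
Qed.

End hilbert.

(** * The Banach algebra of bounded operators *)

Section operator_norm.
Context (R : realType) (H : hilbertType R).
Implicit Types (A B T X Y : bop H) (x y : H).

Lemma bopBE A B x : (A - B) x = A x - B x. Proof. by []. Qed.
Lemma bopME A B x : (A * B) x = A (B x). Proof. by []. Qed.
Lemma bop1E x : (1 : bop H) x = x. Proof. by []. Qed.
Lemma rnorm_bop A : rnorm A = opnorm A. Proof. by []. Qed.

Lemma opnormD A B : opnorm (A + B) <= opnorm A + opnorm B.
Proof. exact: (@rnormD R (bop H)). Qed.

Lemma opnormN A : opnorm (- A) = opnorm A.
Proof. exact: (@rnormN R (bop H)). Qed.

Lemma opnormBC A B : opnorm (A - B) = opnorm (B - A).
Proof. exact: (@rnormBC R (bop H)). Qed.

Lemma opnormB_le A B T : opnorm (A - B) <= opnorm (A - T) + opnorm (T - B).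
Proof. exact: (@rnormB_le R (bop H)). Qed.

Lemma opnormZ (a : R) A : opnorm (a%:C *: A) = `|a| * opnorm A.
Proof. exact: (@rnormZr R (bop H)). Qed.

Lemma opnorm0 : opnorm (0 : bop H) = 0. Proof. exact: (@rnorm0 R (bop H)). Qed.

Lemma opnormM A B : opnorm (A * B) <= opnorm A * opnorm B.
Proof.
apply: opnorm_le => [|x]; first by rewrite mulr_ge0// opnorm_ge0.
rewrite bopME (le_trans (le_opnorm _ _))// -mulrA.
by rewrite ler_wpM2l ?opnorm_ge0// le_opnorm.
Qed.

Lemma opnorm1 : opnorm (1 : bop H) <= 1.
Proof. by apply: opnorm_le => // x; rewrite mul1r. Qed.

Lemma opnormX A n : opnorm (A ^+ n) <= opnorm A ^+ n.
Proof.
elim: n => [|n IH]; first by rewrite !expr0 opnorm1.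
by rewrite !exprS (le_trans (opnormM _ _))// ler_wpM2l ?opnorm_ge0.
Qed.

(** Testing with [y = A x] gives [|A x|^2 <= M |x| |A x|]. This is how estimates of scalar integrals
    become estimates in operator norm. *)
Lemma opnorm_rip_le A (M : R) : 0 <= M ->
  (forall x y, `|rip (A x) y| <= M * (rnorm x * rnorm y)) -> opnorm A <= M.
Proof.
move=> M0 h; apply: opnorm_le => // x; have := h x (A x).
rewrite rip_rnorm ger0_norm ?exprn_ge0 ?rnorm_ge0// mulrA expr2.
have [|Ax0] := leP (rnorm (A x)) 0; last by rewrite ler_pM2r.
by move=> /le_trans -> //; rewrite mulr_ge0// rnorm_ge0.
Qed.

Lemma rip_opnorm A x y : `|rip (A x) y| <= opnorm A * (rnorm x * rnorm y).
Proof.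
rewrite (le_trans (rip_le _ _))// mulrA.
by rewrite ler_wpM2r ?rnorm_ge0 ?le_opnorm.
Qed.

(** The pointwise limit exists by completeness of [H]; letting [m] tend to infinity in
    [|u_n x - u_m x| <= e |x|] makes the convergence uniform on the unit ball. *)
Lemma bop_cauchy_cvg (u : nat -> bop H) :
  (forall e : R, 0 < e -> exists N, forall m n, (N <= m)%N -> (N <= n)%N ->
     opnorm (u m - u n) <= e) -> exists X : bop H, u n @[n --> \oo] --> X.
Proof.
move=> cu.
have lim_pt x : exists y : H, u n x @[n --> \oo] --> y.
  apply: rnorm_cauchy_cvg => e e0.
  have ex0 : 0 < e / (rnorm x + 1) by rewrite divr_gt0// ltr_wpDl ?rnorm_ge0.
  have [N uN] := cu _ ex0; exists N => m n Nm Nn.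
  rewrite -bopBE (le_trans (le_opnorm _ _))//.
  rewrite (le_trans (ler_wpM2r (rnorm_ge0 _) (uN _ _ Nm Nn)))//.
  rewrite mulrAC ler_pdivrMr ?ltr_wpDl ?rnorm_ge0//.
  by apply: ler_wpM2l; [exact: ltW|rewrite lerDl].
have [L uL] := choice lim_pt.
have opL : L \in @is_bounded_op R H.
  apply/asboolP; split => [a x y|].
    apply: (@cvg_unique _ (@norm_hausdorff _ H) _ _ _ _ (uL (a *: x + y))).
    have -> : (fun n => u n (a *: x + y)) = (fun n => a *: u n x + u n y).
      by apply/funext => n; rewrite bop_linear.
    by apply: cvgD => //; apply: cvgZ => //; exact: cvg_cst.
  have [N uN] := cu 1 ltr01; exists (opnorm (u N) + 1) => x.
  rewrite !rnormE -rcM lecR; apply: (rnorm_lim_le (uL x)).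
  exists N => // n /= Nn; rewrite (le_trans (le_opnorm _ _))//.
  rewrite ler_wpM2r ?rnorm_ge0// -[u n](subrK (u N)) addrC.
  by rewrite (le_trans (opnormD _ _))// lerD2l uN.
exists (Bop opL); apply/rnorm_cvgP/cvgrPdist_le => e e0.
have [N uN] := cu _ e0; exists N => // n /= Nn.
rewrite sub0r normrN ger0_norm ?opnorm_ge0//; apply: opnorm_le; first exact: ltW.
move=> x; apply: (@rnorm_lim_le _ _ (fun m => u n x - u m x)).
  by apply: cvgB => //; exact: cvg_cst.
exists N => // m /= Nm; rewrite -bopBE (le_trans (le_opnorm _ _))//.
by rewrite ler_wpM2r ?rnorm_ge0// uN.
Qed.

Lemma bop_cvgM (u v : nat -> bop H) X Y :
  u n @[n --> \oo] --> X -> v n @[n --> \oo] --> Y ->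
  (u n * v n) @[n --> \oo] --> X * Y.
Proof.
move=> /rnorm_cvgP uX /rnorm_cvgP vY.
apply: (@rnorm_squeeze _ _ _ _ (fun n => (opnorm (u n - X) + opnorm X) *
    opnorm (v n - Y) + opnorm (u n - X) * opnorm Y)).
  move=> n; have -> : u n * v n - X * Y = u n * (v n - Y) + (u n - X) * Y.
    by rewrite mulrBr mulrBl addrA subrK.
  rewrite (le_trans (rnormD _ _))// lerD ?opnormM//.
  rewrite (le_trans (opnormM _ _))// ler_wpM2r ?opnorm_ge0//.
  by rewrite -{1}[u n](subrK X) opnormD.
rewrite [X in _ --> X](_ : 0 = (0 + opnorm X) * 0 + 0 * opnorm Y); last first.
  by rewrite mulr0 mul0r addr0.
by apply: cvgD; apply: cvgM => //; [apply: cvgD => //|]; exact: cvg_cst.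
Qed.

Lemma neumann T : opnorm T < 1 -> invertible (1 - T).
Proof.
set q := opnorm T => q1; pose S n := \sum_(k < n) T ^+ k.
(* Multiplied by [1 - q], the majorizing geometric sum telescopes, so this is a plain induction on
   [k]. *)
have dS n k : (1 - q) * opnorm (S (n + k)%N - S n) <= q ^+ n - q ^+ (n + k).
  elim: k => [|k IH]; first by rewrite addn0 !subrr opnorm0 mulr0.
  rewrite addnS {1}/S big_ord_recr/= -/(S _) addrAC.
  rewrite (@le_trans _ _ ((1 - q) * (opnorm (S (n + k)%N - S n) + q ^+ (n + k))))//.
    apply: ler_wpM2l; first by rewrite subr_ge0 ltW.
    by rewrite (le_trans (opnormD _ _))// lerD2l opnormX.
  by rewrite exprS; move: IH; lra.
have q0 : 0 <= q by exact: opnorm_ge0.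
have [X SX] : exists X, S n @[n --> \oo] --> X.
  apply: bop_cauchy_cvg => e e0.
  have : q ^+ n @[n --> \oo] --> 0 by apply: cvg_expr; rewrite ger0_norm.
  have e'0 : 0 < e / 2 * (1 - q) by rewrite mulr_gt0 ?divr_gt0// subr_gt0.
  move=> /cvgrPdist_le/(_ _ e'0)[N _ /(_ N (leqnn N))].
  rewrite sub0r normrN ger0_norm ?exprn_ge0// => qN.
  have h m : (N <= m)%N -> opnorm (S m - S N) <= e / 2.
    move=> /subnKC <-; have := dS N (m - N)%N; set a := opnorm _ => ha.
    have : (1 - q) * a <= e / 2 * (1 - q).
      by apply: le_trans qN; rewrite (le_trans ha)// gerBl exprn_ge0.
    by rewrite mulrC ler_pM2r// subr_gt0.
  exists N => m n Nm Nn; rewrite (le_trans (opnormB_le _ _ (S N)))//.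
  rewrite [leRHS](splitr e).
  by rewrite lerD// ?h// opnormBC h.
have TS n : (1 - T) * S n = 1 - T ^+ n /\ S n * (1 - T) = 1 - T ^+ n.
  elim: n => [|n [IH1 IH2]].
    by rewrite /S big_ord0 mulr0 mul0r expr0 subrr.
  have -> : S n.+1 = S n + T ^+ n by rewrite /S big_ord_recr.
  rewrite mulrDr IH1 [in X in _ /\ X]mulrDl IH2.
  by rewrite mulrBr mulrBl mul1r mulr1 -exprS -exprSr addrA subrK.
have cT : (1 - T ^+ n) @[n --> \oo] --> (1 : bop H).
  apply: (@rnorm_squeeze _ _ _ _ (fun n => q ^+ n)).
    by move=> n; rewrite addrAC subrr add0r rnormN opnormX.
  by apply: cvg_expr; rewrite ger0_norm.
have uniq := @cvg_unique _ (@norm_hausdorff _ (bop H)).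
have uniqT Y : 1 - T ^+ n @[n --> \oo] --> Y -> Y = 1.
  by move=> cY; exact: uniq cY cT.
exists X; split; apply: uniqT.
- rewrite -(funext (fun n => (TS n).2)).
  by apply: bop_cvgM => //; exact: cvg_cst.
- rewrite -(funext (fun n => (TS n).1)).
  by apply: bop_cvgM => //; exact: cvg_cst.
Qed.

Lemma invertibleM A B : invertible A -> invertible B -> invertible (A * B).
Proof.
move=> [A' [A'A AA']] [B' [B'B BB']]; exists (B' * A'); split.
  by rewrite mulrA -(mulrA B') A'A mulr1.
by rewrite mulrA -(mulrA A) BB' mulr1.
Qed.

Lemma invertibleZ (a : R[i]) A : a != 0 -> invertible A -> invertible (a *: A).
Proof.
move=> a0 [S [SA AS]]; exists (a^-1 *: S).
by rewrite -!bop_scaleAl -!bop_scaleAr !scalerA SA AS divff// mulVf// scale1r.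
Qed.

Lemma invertible_sub_scalar T (w : R[i]) :
  opnorm T < complex.Re `|w| -> invertible (T - w *: (1 : bop H)).
Proof.
move=> Tw; have w0 : w != 0.
  by apply: contraTneq Tw => ->; rewrite normr0 -leNgt opnorm_ge0.
have -> : T - w *: (1 : bop H) = - w *: (1 - w^-1 *: T).
  by rewrite scalerBr scalerA mulNr divff// scaleN1r opprK addrC scaleNr.
apply: invertibleZ; first by rewrite oppr_eq0.
apply: neumann; rewrite -rnorm_bop rnormZ normfV.
have w0' : 0 < complex.Re `|w| by exact: le_lt_trans (opnorm_ge0 T) Tw.
have -> : complex.Re `|w|^-1 = (complex.Re `|w|)^-1.
  by apply: (@complexI R); rewrite -normfV -Defs.normcE normfV {1}Defs.normcE -fmorphV.
by rewrite mulrC ltr_pdivrMr// mul1r.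
Qed.

End operator_norm.

(** * Spectra of self-adjoint operators *)

Section spectral_radius.
Context (R : realType) (H : hilbertType R).
Implicit Types (A B T X Y : bop H) (x y : H).

Lemma selfadjointP A :
  selfadjoint A <-> forall x y, rip (A x) y = rip x (A y).
Proof.
split=> [sA x y|sA x y]; first by rewrite /rip sA.
by apply: innerP => //; rewrite sA bopZ.
Qed.

Lemma selfadjoint1 : selfadjoint (1 : bop H). Proof. by []. Qed.

Lemma selfadjointD A B : selfadjoint A -> selfadjoint B -> selfadjoint (A + B).
Proof.
move=> /selfadjointP sA /selfadjointP sB; apply/selfadjointP => x y.
by rewrite !bopDE ripDl ripDr sA sB.
Qed.

Lemma selfadjointZ (a : R) A : selfadjoint A -> selfadjoint (a%:C *: A).
Proof.
move=> /selfadjointP sA; apply/selfadjointP => x y.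
by rewrite !bopZE ripZl ripZr sA.
Qed.

Lemma selfadjoint0 : selfadjoint (0 : bop H).
Proof. by rewrite -(scale0r (1 : bop H)); exact/selfadjointZ/selfadjoint1. Qed.

Lemma selfadjointX A n : selfadjoint A -> selfadjoint (A ^+ n).
Proof.
move=> sA; elim: n => [|n IH]; first exact: selfadjoint1.
by move=> x y; rewrite {1}exprS exprSr !bopME sA IH.
Qed.

Lemma selfadjointB_scalar A (c : R) :
  selfadjoint A -> selfadjoint (A - c%:C *: (1 : bop H)).
Proof.
move=> sA; rewrite -scaleNr -rmorphN; apply: selfadjointD => //.
exact/selfadjointZ/selfadjoint1.
Qed.

Lemma selfadjoint_lim (u : nat -> bop H) X :
  (forall n, selfadjoint (u n)) -> u n @[n --> \oo] --> X -> selfadjoint X.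
Proof.
move=> su /rnorm_cvgP uX; apply/selfadjointP => x y.
apply/eqP; rewrite -subr_eq0 -normr_le0; apply/ler_addgt0Pr => e e0; rewrite add0r.
pose M := rnorm x * rnorm y.
(* The factor 2 pays for the two error terms, and the added 1 keeps the denominator positive when
   [x] or [y] is zero. *)
have M1 : 0 < 2 * (M + 1) by rewrite mulr_gt0// ltr_wpDl// mulr_ge0 ?rnorm_ge0.
have e'0 : 0 < e / (2 * (M + 1)) by rewrite divr_gt0.
have /cvgrPdist_lt/(_ _ e'0)[N _ /(_ N (leqnn N))] := uX.
rewrite sub0r normrN ger0_norm ?opnorm_ge0// => /ltW uN.
have -> : rip (X x) y - rip x (X y) =
    - rip ((u N - X) x) y + rip x ((u N - X) y).
  have /selfadjointP sN := su N.
  by rewrite !bopBE ripBl ripBr sN; ring.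
rewrite (le_trans (ler_normD _ _))// normrN (ripC x).
rewrite (le_trans (lerD (rip_opnorm _ _ _) (rip_opnorm _ _ _)))//.
rewrite (mulrC (rnorm y)) -/M -mulrDr.
rewrite (@le_trans _ _ (e / (2 * (M + 1)) * (M + M)))//.
  by rewrite ler_wpM2r ?addr_ge0 ?mulr_ge0 ?rnorm_ge0.
rewrite mulrAC ler_pdivrMr// ler_wpM2l ?(ltW e0)//; lra.
Qed.

Lemma opnorm_gt0_nontrivial A : 0 < opnorm A -> (1 : bop H) <> 0.
Proof.
by move=> A0 e; move: A0; rewrite -[A]mulr1 e mulr0 opnorm0 ltxx.
Qed.

(* With [n = |T|] one has [|(T^2 - n^2) x|^2 <= n^2 (n^2 |x|^2 - |T x|^2)], so an
   inverse of [T^2 - n^2] would bound [|T|] away from [n]. *)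
Lemma sqr_opnorm_not_invertible T : (1 : bop H) <> 0 -> selfadjoint T ->
  ~ invertible (T * T - (opnorm T ^+ 2)%:C *: (1 : bop H)).
Proof.
move=> nt /selfadjointP sT [S [ST _]]; set n := opnorm T in ST.
have n_ge0 : 0 <= n := opnorm_ge0 T.
have keyT x : rnorm ((T * T - (n ^+ 2)%:C *: (1 : bop H)) x) ^+ 2 <=
    n ^+ 2 * (n ^+ 2 * rnorm x ^+ 2 - rnorm (T x) ^+ 2).
  rewrite -rip_rnorm bopBE bopME bopZE bop1E !(ripBl, ripBr) !(ripZl, ripZr).
  rewrite (ripC x (T (T x))) [rip (T (T x)) x]sT !rip_rnorm.
  have : rnorm (T (T x)) ^+ 2 <= (n * rnorm (T x)) ^+ 2.
    by rewrite ler_sqr ?nnegrE ?mulr_ge0 ?rnorm_ge0 ?le_opnorm.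
  by rewrite exprMn; lra.
have n_gt0 : 0 < n.
  rewrite lt_neqAle n_ge0 andbT eq_sym; apply/eqP => n0; apply: nt.
  have T0 : T = 0 by exact: (@rnorm_eq0 _ (bop H)).
  by rewrite -ST n0 T0 expr0n/= scale0r mulr0 subrr mulr0.
set s := opnorm S.
have xS x : rnorm x ^+ 2 <= s ^+ 2 *
    (n ^+ 2 * (n ^+ 2 * rnorm x ^+ 2 - rnorm (T x) ^+ 2)).
  rewrite (le_trans _ (ler_wpM2l _ (keyT x))) ?sqr_ge0// -exprMn.
  rewrite ler_sqr ?nnegrE ?mulr_ge0 ?rnorm_ge0 ?opnorm_ge0//.
  have := le_opnorm S ((T * T - (n ^+ 2)%:C *: (1 : bop H)) x).
  by rewrite -bopME ST bop1E.
have s_gt0 : 0 < s.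
  rewrite lt_neqAle opnorm_ge0 andbT eq_sym; apply/eqP => s0; apply: nt.
  have S0 : S = 0 by exact: (@rnorm_eq0 _ (bop H)).
  by rewrite -ST S0 mul0r.
(* [xS] rearranges to [|T x|^2 <= (n^2 - 1 / (s n)^2) |x|^2]; the maximum with 0 makes the square
   root legitimate. *)
pose q := Num.max 0 (n ^+ 2 - (s ^+ 2 * n ^+ 2)^-1).
have q0 : 0 <= q by rewrite le_max lexx.
have sn0 : 0 < s ^+ 2 * n ^+ 2 by rewrite mulr_gt0 ?exprn_gt0.
have : n <= Num.sqrt q.
  apply: opnorm_le; first exact: sqrtr_ge0.
  move=> x; rewrite -ler_sqr ?nnegrE ?mulr_ge0 ?rnorm_ge0 ?sqrtr_ge0//.
  rewrite exprMn sqr_sqrtr//.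
  rewrite (@le_trans _ _ ((n ^+ 2 - (s ^+ 2 * n ^+ 2)^-1) * rnorm x ^+ 2))//.
    have := xS x; rewrite mulrA -ler_pdivrMl// mulrBl; lra.
  by rewrite ler_wpM2r ?sqr_ge0// le_max lexx orbT.
rewrite -ler_sqr ?nnegrE ?sqrtr_ge0// sqr_sqrtr// le_max.
rewrite leNgt exprn_gt0//= lerBrDl gerDr leNgt invr_gt0 sn0.
by [].
Qed.

(** Complex coefficients allow a splitting into linear factors; real polynomials enter through
    [poly_opE]. *)
Definition cpoly_op (q : {poly R[i]}) A : bop H :=
  \sum_(i < size q) q`_i *: A ^+ i.

Lemma cpoly_opE (q : {poly R[i]}) A N : (size q <= N)%N ->
  cpoly_op q A = \sum_(i < N) q`_i *: A ^+ i.
Proof.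
move=> qN; rewrite /cpoly_op (big_ord_widen _ (fun i => q`_i *: A ^+ i) qN).
rewrite big_mkcond/=; apply: eq_bigr => i _; case: ifPn => //.
by rewrite -leqNgt => /(nth_default 0) ->; rewrite scale0r.
Qed.

Lemma cpoly_opD (p q : {poly R[i]}) A :
  cpoly_op (p + q) A = cpoly_op p A + cpoly_op q A.
Proof.
pose N := maxn (size p) (size q).
rewrite (@cpoly_opE _ _ N) ?size_polyD// (@cpoly_opE p _ N) ?leq_maxl//.
rewrite (@cpoly_opE q _ N) ?leq_maxr// -big_split/=.
by apply: eq_bigr => i _; rewrite coefD scalerDl.
Qed.

Lemma cpoly_opZ (c : R[i]) (p : {poly R[i]}) A :
  cpoly_op (c *: p) A = c *: cpoly_op p A.
Proof.
rewrite (@cpoly_opE _ _ (size p)) ?size_scale_leq// scaler_sumr.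
by apply: eq_bigr => i _; rewrite coefZ scalerA.
Qed.

Lemma cpoly_opMX (p : {poly R[i]}) A : cpoly_op (p * 'X) A = cpoly_op p A * A.
Proof.
rewrite (@cpoly_opE _ _ (size p).+1); last first.
  by rewrite (leq_trans (size_polyMleq _ _))// size_polyX addn2.
rewrite big_ord_recl coefMX/= scale0r add0r /cpoly_op mulr_suml.
by apply: eq_bigr => i _; rewrite coefMX/= exprSr bop_scaleAl.
Qed.

Lemma cpoly_opC (c : R[i]) A : cpoly_op c%:P A = c *: (1 : bop H).
Proof.
rewrite (@cpoly_opE _ _ 1) ?size_polyC_leq1// big_ord_recl big_ord0 addr0/=.
by rewrite coefC/= expr0.
Qed.

Lemma cpoly_opM (p q : {poly R[i]}) A :
  cpoly_op (p * q) A = cpoly_op p A * cpoly_op q A.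
Proof.
elim/poly_ind: q => [|q c IH].
  have c0 : cpoly_op 0 A = 0 by rewrite -polyC0 cpoly_opC scale0r.
  by rewrite mulr0 c0 mulr0.
rewrite mulrDr mulrA !cpoly_opD !cpoly_opMX IH mulrC mul_polyC cpoly_opZ.
by rewrite cpoly_opC mulrDr mulrA -bop_scaleAr mulr1.
Qed.

Lemma cpoly_opX A : cpoly_op 'X A = A.
Proof. by rewrite -['X]mul1r cpoly_opMX cpoly_opC scale1r mul1r. Qed.

Lemma cpoly_opN (p : {poly R[i]}) A : cpoly_op (- p) A = - cpoly_op p A.
Proof. by rewrite -scaleN1r cpoly_opZ scaleN1r. Qed.

(** Half of the spectral mapping theorem: [q] splits over the algebraically closed [R[i]], and if no
    root were in the spectrum, [q(A)] would be a product of invertible operators. *)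
Lemma cpoly_op_spectrum (q : {poly R[i]}) A : q != 0 ->
  ~ invertible (cpoly_op q A) -> exists2 z, root q z & spectrum A z.
Proof.
move=> q0 nq; apply: contrapT => noroot; apply: nq.
have [r qE] := closed_field_poly_normal q.
have rA z : z \in r -> invertible (A - z *: (1 : bop H)).
  move=> zr; apply: contrapT => Az; apply: noroot; exists z => //.
  by rewrite qE rootZ ?lead_coef_eq0// root_prod_XsubC.
rewrite qE cpoly_opZ; apply: invertibleZ; first by rewrite lead_coef_eq0.
elim: r {qE} rA => [_|z r IH rA].
  by rewrite big_nil cpoly_opC scale1r; exists 1; rewrite mulr1.
rewrite big_cons cpoly_opM; apply: invertibleM.
  by rewrite cpoly_opD cpoly_opX cpoly_opN cpoly_opC; apply: rA; exact: mem_head.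
by apply: IH => t tr; apply: rA; rewrite in_cons tr orbT.
Qed.

(** In place of Liouville's theorem: [X^2 - |A|^2] has a non-invertible value at [A], so one of its
    roots is in the spectrum. *)
Lemma spectrum_neq0 A : (1 : bop H) <> 0 -> selfadjoint A ->
  exists z, spectrum A z.
Proof.
move=> nt sA; pose q : {poly R[i]} := 'X * 'X - ((opnorm A ^+ 2)%:C)%:P.
have [|q0|z _ Az] := @cpoly_op_spectrum q A; last by exists z.
  rewrite -size_poly_eq0 /q -expr2 size_polyDl ?size_polyXn// size_polyN.
  by rewrite (leq_ltn_trans (size_polyC_leq1 _)).
move: q0; rewrite /q cpoly_opD cpoly_opM cpoly_opX cpoly_opN cpoly_opC.
exact: sqr_opnorm_not_invertible.
Qed.

Local Notation toC p := (map_poly (real_complex R) p).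

Lemma poly_opE (p : {poly R}) A : poly_op p A = cpoly_op (toC p) A.
Proof.
rewrite /poly_op /cpoly_op size_map_poly.
by apply: eq_bigr => i _; rewrite coef_map.
Qed.

Lemma poly_opB (p q : {poly R}) A : poly_op (p - q) A = poly_op p A - poly_op q A.
Proof. by rewrite !poly_opE rmorphB cpoly_opD cpoly_opN. Qed.

Lemma selfadjoint_poly_op (p : {poly R}) A :
  selfadjoint A -> selfadjoint (poly_op p A).
Proof.
move=> sA; rewrite /poly_op; apply: big_ind => [||i _].
- exact: selfadjoint0.
- exact: selfadjointD.
- exact/selfadjointZ/selfadjointX.
Qed.

(** If [n = |p(A)|] exceeded [M], the non-invertible [p(A)^2 - n^2] would give [p^2 - n^2] a root
    [x] in the spectrum, and there [|p(x)| = n > M]. *)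
Lemma opnorm_poly_op (p : {poly R}) A (M : R) : selfadjoint A ->
  (forall z, spectrum A z -> exists x : R, z = x%:C) ->
  0 <= M -> (forall x : R, spectrum A x%:C -> `|p.[x]| <= M) ->
  opnorm (poly_op p A) <= M.
Proof.
move=> sA specR M0 pM; rewrite leNgt; apply/negP; set n := opnorm _ => Mn.
have nt : (1 : bop H) <> 0.
  by apply: (@opnorm_gt0_nontrivial (poly_op p A)); exact: le_lt_trans Mn.
pose q := p * p - (n ^+ 2)%:P.
have qE : cpoly_op (toC q) A = poly_op p A * poly_op p A - (n ^+ 2)%:C *: (1 : bop H).
  by rewrite rmorphB rmorphM/= map_polyC cpoly_opD cpoly_opN cpoly_opM cpoly_opC poly_opE.
have nq : ~ invertible (cpoly_op (toC q) A).
  by rewrite qE; exact: sqr_opnorm_not_invertible nt (selfadjoint_poly_op p sA).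
have [z qz Az] : exists2 z, root (toC q) z & spectrum A z.
  (* When [p] is the constant [n] or [-n], the polynomial [q] vanishes and any point of the spectrum
     will do; there is one by [spectrum_neq0]. *)
  have [->|q0] := eqVneq (toC q) 0; last exact: cpoly_op_spectrum.
  by have [z Az] := spectrum_neq0 nt sA; exists z => //; rewrite root0.
have [x zx] := specR _ Az; rewrite zx in qz Az.
have : q.[x] = 0.
  by apply: (@complexI R); rewrite -horner_map; exact/eqP.
rewrite /q hornerD hornerN hornerM hornerC => /eqP; rewrite subr_eq0 -expr2.
rewrite -(real_normK (num_real _)) eqrXn2// ?opnorm_ge0// => /eqP pn.
by have := pM _ Az; rewrite pn leNgt Mn.
Qed.

Lemma le_opnorm_spectrum A (c x : R) : spectrum A x%:C ->
  `|x - c| <= opnorm (A - c%:C *: (1 : bop H)).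
Proof.
move=> Ax; rewrite leNgt; apply/negP => h; apply: Ax.
have -> : A - x%:C *: (1 : bop H) =
    (A - c%:C *: (1 : bop H)) - (x - c)%:C *: (1 : bop H).
  by rewrite rmorphB scalerBl opprB addrA subrK.
by apply: invertible_sub_scalar; rewrite Re_normc.
Qed.

(** With [T = A - c], the non-invertible [T^2 - n^2] is the product of [A - (c + n)] and
    [A - (c - n)], so the two factors are not both invertible. *)
Lemma spectrum_extreme A (c : R) : (1 : bop H) <> 0 -> selfadjoint A ->
  let n := opnorm (A - c%:C *: (1 : bop H)) in
  spectrum A (c + n)%:C \/ spectrum A (c - n)%:C.
Proof.
move=> nt sA n; pose T := A - c%:C *: (1 : bop H).
have nT := sqr_opnorm_not_invertible nt (selfadjointB_scalar c sA).
apply: contrapT => /not_orP[/contrapT inv1 /contrapT inv2]; apply: nT.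
rewrite -/T -/n.
have -> : T * T - (n ^+ 2)%:C *: (1 : bop H) =
    (A - (c + n)%:C *: (1 : bop H)) * (A - (c - n)%:C *: (1 : bop H)).
  have -> : A - (c + n)%:C *: (1 : bop H) = T - n%:C *: (1 : bop H).
    by rewrite rmorphD/= scalerDl opprD addrA.
  have -> : A - (c - n)%:C *: (1 : bop H) = T + n%:C *: (1 : bop H).
    by rewrite rmorphB/= scalerBl opprB addrA addrAC.
  clearbody T; rewrite mulrDr !mulrBl -!bop_scaleAl !mul1r -!bop_scaleAr mulr1.
  by rewrite scalerA -rmorphM -expr2 addrA subrK.
exact: invertibleM.
Qed.

Lemma opnorm_center A (a b : R) : (1 : bop H) <> 0 -> selfadjoint A ->
  (forall x : R, spectrum A x%:C -> a <= x <= b) ->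
  opnorm (A - ((a + b) / 2)%:C *: (1 : bop H)) <= (b - a) / 2.
Proof.
move=> nt sA Aab; set c := (a + b) / 2.
by have [/Aab|/Aab] := spectrum_extreme c nt sA; rewrite /c; lra.
Qed.

(** The end points are taken in the spectrum itself, so they lie in [I] even when [I] is not closed.
    From the centre [-K], left of the spectrum, the farthest spectral point is the maximum; from [K]
    it is the minimum. *)
Lemma spectrum_hull (I : set R) A : (1 : bop H) <> 0 -> sa_in I A ->
  exists a b : R, [/\ I a, I b & forall x : R, spectrum A x%:C -> a <= x <= b].
Proof.
move=> nt [sA AI]; pose K := opnorm A + 1.
have A0 (x : R) : spectrum A x%:C -> `|x| <= opnorm A.
  by move=> /(le_opnorm_spectrum 0); rewrite scale0r !subr0.
have K1 : opnorm A < K by rewrite ltrDl.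
have I_spec (x : R) : spectrum A x%:C -> I x.
  by move=> /AI[y Iy /(@complexI R) <-].
set n := opnorm (A - (- K)%:C *: (1 : bop H)).
set m := opnorm (A - K%:C *: (1 : bop H)).
(* The other alternative, [- K - n], has absolute value at least [K > |A|]. *)
have nA : spectrum A (- K + n)%:C.
  have [//|/A0] := spectrum_extreme (- K) nt sA; rewrite -/n ler_norml.
  by have := opnorm_ge0 (A - (- K)%:C *: (1 : bop H)); rewrite -/n; lra.
have mA : spectrum A (K - m)%:C.
  have [/A0|//] := spectrum_extreme K nt sA; rewrite -/m ler_norml.
  by have := opnorm_ge0 (A - K%:C *: (1 : bop H)); rewrite -/m; lra.
exists (K - m), (- K + n); split; [exact: I_spec|exact: I_spec|move=> x Ax].
have := le_opnorm_spectrum (- K) Ax; have := le_opnorm_spectrum K Ax.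
by rewrite -/m -/n !ler_norml; lra.
Qed.

(** Pythagoras: [<T x, x>] is real, so the cross term in [|T x + i K x|^2] vanishes. *)
Lemma opnorm_shift_im T (r K : R) : selfadjoint T -> opnorm T <= r ->
  opnorm (T + (0 +i* K) *: (1 : bop H)) <= Num.sqrt (r ^+ 2 + K ^+ 2).
Proof.
move=> sT Tr; have r0 : 0 <= r by exact: le_trans (opnorm_ge0 _) Tr.
have rK : 0 <= r ^+ 2 + K ^+ 2 by rewrite addr_ge0 ?sqr_ge0.
apply: opnorm_le => [|x]; first exact: sqrtr_ge0.
rewrite -ler_sqr ?nnegrE ?mulr_ge0 ?rnorm_ge0 ?sqrtr_ge0//.
rewrite exprMn sqr_sqrtr// bopDE bopZE bop1E.
have -> : 0 +i* K = K%:C * 'i.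
  apply/eqP; rewrite eq_complex/=.
  by apply/andP; split; apply/eqP; ring.
rewrite -scalerA -rip_rnorm !(ripDl, ripDr) !(ripZl, ripZr).
rewrite (ripC _ (T x)) -Im_inner.
have -> : complex.Im (inner (T x) x) = 0.
  have : inner (T x) x = (inner (T x) x)^* by rewrite -inner_conj -sT.
  by case: (inner (T x) x) => u v [] /=; lra.
have -> : rip ('i *: x) ('i *: x) = rnorm x ^+ 2.
  by rewrite rip_rnorm rnormZ normc_def/= expr0n expr1n/= add0r sqrtr1 mul1r.
rewrite rip_rnorm.
have : rnorm (T x) ^+ 2 <= (r * rnorm x) ^+ 2.
  rewrite ler_sqr ?nnegrE ?mulr_ge0 ?rnorm_ge0//.
  by rewrite (le_trans (le_opnorm _ _))// ler_wpM2r ?rnorm_ge0.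
by rewrite exprMn; lra.
Qed.

(* Moving the centre of the Neumann series far along the imaginary axis reaches
   every non-real point of the resolvent set. *)
Lemma spectrum_ball A (c r : R) (z : R[i]) : selfadjoint A ->
  opnorm (A - c%:C *: (1 : bop H)) <= r -> spectrum A z ->
  exists2 x : R, z = x%:C & c - r <= x <= c + r.
Proof.
move=> sA Ar Az; pose T := A - c%:C *: (1 : bop H).
have r0 : 0 <= r by exact: le_trans (opnorm_ge0 _) Ar.
case: z Az => s t Az.
have far K : (s - c) ^+ 2 + (t + K) ^+ 2 <= r ^+ 2 + K ^+ 2.
  rewrite leNgt; apply/negP => h; apply: Az.
  have -> : A - (s +i* t) *: (1 : bop H) = (T + (0 +i* K) *: (1 : bop H)) -
      ((s - c) +i* (t + K)) *: (1 : bop H).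
    rewrite /T -!addrA; congr (_ + _); rewrite -!scaleNr -!scalerDl.
    congr (_ *: _); apply/eqP; rewrite eq_complex/=.
    by apply/andP; split; apply/eqP; ring.
  apply: invertible_sub_scalar; rewrite normc_def/=.
  rewrite (le_lt_trans (opnorm_shift_im K (selfadjointB_scalar c sA) Ar))//.
  by rewrite ltr_sqrt// (le_lt_trans _ h)// addr_ge0 ?sqr_ge0.
have t0 : t = 0.
  (* With this [K] the cross term [2 t K] of [(t + K)^2] equals [r^2], and [far K] reduces to
     [(s - c)^2 + t^2 <= 0]. *)
  apply/eqP; apply: contraT => t0; have := far (r ^+ 2 / (2 * t)).
  have -> : (t + r ^+ 2 / (2 * t)) ^+ 2 =
      t ^+ 2 + r ^+ 2 + (r ^+ 2 / (2 * t)) ^+ 2 by field.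
  have : 0 < t ^+ 2 by rewrite exprn_even_gt0.
  by have := sqr_ge0 (s - c); lra.
have := far 0; rewrite t0 addr0 expr0n/= !addr0 => h.
have /ler_normlP : `|s - c| <= r.
  by rewrite -ler_sqr ?nnegrE// real_normK ?num_real.
by move=> [? ?]; exists s => //; apply/andP; split; lra.
Qed.

End spectral_radius.


(** * Weierstrass' theorem by Bernstein polynomials *)

Section weierstrass.
Context (R : realType).
Implicit Types (f : R -> R) (g h : nat -> R) (x y : R) (q : {poly R}).

Lemma segment_continuousP f (a b : R) x (e : R) :
  {within `[a, b], continuous f} -> 0 < e -> x \in `[a, b] ->
  exists2 r : R, 0 < r & forall y, y \in `[a, b] -> `|x - y| < r ->
  `|f x - f y| < e.
Proof.
move=> /subspace_continuousP cf e0 xab.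
have /cf/cvgrPdist_lt/(_ _ e0) : `[a, b]%classic x by [].
rewrite near_withinE => /nbhs_ballP[r /= r0 fr]; exists r => // y yab xy.
exact: fr.
Qed.

Lemma segment_unif_continuous f (a b : R) (e : R) :
  {within `[a, b], continuous f} -> 0 < e ->
  exists2 d : R, 0 < d & forall x y, x \in `[a, b] -> y \in `[a, b] ->
  `|x - y| < d -> `|f x - f y| < e.
Proof.
move=> cf e0; have /compact_near_coveringP near_cov := @segment_compact R a b.
pose P (d x : R) := x \in `[a, b] ->
  forall y, y \in `[a, b] -> `|x - y| < d -> `|f x - f y| < e.
have := near_cov _ (0 : R)^'+ P _; case.
  move=> x xab; have e20 : 0 < e / 2 by rewrite divr_gt0.
  have [r r0 fr] := segment_continuousP cf e20 xab.
  have r20 : 0 < r / 2 by rewrite divr_gt0.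
  exists (ball x (r / 2), [set d | d < r / 2]).
    by split => /=; [exact: nbhsx_ballx|exact: nbhs_right_lt].
  move=> [x' d] /= [xx' dr] x'ab y yab x'y.
  rewrite -ball_normE /= in xx'.
  have h1 : `|f x - f x'| < e / 2 by apply: fr => //; rewrite (lt_trans xx')//; lra.
  have h2 : `|f x - f y| < e / 2.
    apply: fr => //; rewrite (le_lt_trans (ler_distD x' _ _))//.
    by rewrite (splitr r) ltrD// (lt_trans x'y).
  rewrite (le_lt_trans (ler_distD (f x) _ _))// (splitr e) ltrD//.
  by rewrite distrC.
move=> r /= r0 h; exists (r / 2); first by rewrite divr_gt0.
move=> x y xab yab xy; apply: (h (r / 2)) => //=.
- by rewrite sub0r normrN gtr0_norm ?divr_gt0//; lra.
- by rewrite divr_gt0.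
Qed.

Lemma segment_bounded f (a b : R) : {within `[a, b], continuous f} ->
  exists2 M : R, 0 <= M & forall x, x \in `[a, b] -> `|f x| <= M.
Proof.
move=> cf; have [ab|ba] := leP a b; last first.
  exists 0 => // x; rewrite in_itv/= => /andP[ax xb].
  by have := le_lt_trans (le_trans ax xb) ba; rewrite ltxx.
have [c cab fc] := EVT_max ab cf; have [d dab fd] := EVT_min ab cf.
exists (`|f c| + `|f d|); first exact: addr_ge0.
move=> x xab; rewrite ler_norml; have := fc _ xab; have := fd _ xab.
have := ler_norm (f c); have := ler_norm (- f d); rewrite normrN.
by have := normr_ge0 (f c); have := normr_ge0 (f d); lra.
Qed.

(* The Bernstein operator, through the recursion obtained by conditioning on the
   last of [n] coin tosses of bias [x]: the expectation of [g] at the number of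
   successes. *)
Fixpoint bernstein x (n : nat) g : R :=
  if n is m.+1 then (1 - x) * bernstein x m g + x * bernstein x m (g \o S)
  else g 0%N.

(** The bias [q] is itself a polynomial, so that the affine change of variable from [[a, b]] to
    [[0, 1]] is built in. *)
Fixpoint bernstein_poly q (n : nat) g : {poly R} :=
  if n is m.+1 then (1 - q) * bernstein_poly q m g + q * bernstein_poly q m (g \o S)
  else (g 0%N)%:P.

Lemma horner_bernstein_poly q n g x :
  (bernstein_poly q n g).[x] = bernstein q.[x] n g.
Proof.
elim: n g => [|n IH] g /=; first by rewrite hornerC.
by rewrite hornerD !hornerM hornerD hornerN hornerC !IH.
Qed.

Lemma le_bernstein x n g h : 0 <= x <= 1 ->
  (forall k, (k <= n)%N -> g k <= h k) -> bernstein x n g <= bernstein x n h.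
Proof.
move=> /andP[x0 x1]; elim: n g h => [|n IH] g h gh /=; first exact: gh.
apply: lerD; apply: ler_wpM2l; rewrite ?subr_ge0//; apply: IH => k kn /=.
  by apply: gh; rewrite leqW.
by apply: gh.
Qed.

Lemma bernstein_affine x n (c d : R) g :
  bernstein x n (fun k => c + d * g k) = c + d * bernstein x n g.
Proof.
elim: n g => [//|n IH] g /=.
by rewrite IH (_ : _ \o S = fun k => c + d * (g \o S) k)// IH; ring.
Qed.

(** Squared bias plus the binomial variance. The centre [c] is arbitrary because a success in the
    recursion moves it to [c - 1]. *)
Lemma bernstein_variance x n (c : R) :
  bernstein x n (fun k => (k%:R - c) ^+ 2) =
  (n%:R * x - c) ^+ 2 + n%:R * (x * (1 - x)).
Proof.
elim: n c => [|n IH] c /=; first by rewrite !mul0r addr0.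
have -> : (fun k => (k%:R - c) ^+ 2) \o S =
    (fun k => (k%:R - (c - 1)) ^+ 2) :> (nat -> R).
  by apply/funext => k /=; rewrite -natr1; congr (_ ^+ 2); ring.
by rewrite !IH -natr1; ring.
Qed.

(** Chebyshev's argument: the operator is monotone, so a quadratic majorant of the error contributes
    at most [C] times the variance, and [n x (1 - x) <= n]. *)
Lemma bernstein_approx x n g (y e C : R) : 0 <= x <= 1 -> 0 <= C ->
  (forall k, (k <= n)%N -> `|g k - y| <= e + C * (k%:R - n%:R * x) ^+ 2) ->
  `|bernstein x n g - y| <= e + C * n%:R.
Proof.
move=> x01 C0 gy; pose v k : R := (k%:R - n%:R * x) ^+ 2.
have vn : bernstein x n v <= n%:R.
  rewrite bernstein_variance subrr expr0n/= add0r ler_piMr//.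
  by move: x01 => /andP[? ?]; nra.
have Cv : C * bernstein x n v <= C * n%:R by rewrite ler_wpM2l.
have up : bernstein x n g <= y + e + C * bernstein x n v.
  rewrite -bernstein_affine; apply: le_bernstein => // k kn.
  by have := gy _ kn; rewrite ler_norml -/(v k); lra.
have lo : y - e - C * bernstein x n v <= bernstein x n g.
  rewrite -mulNr -bernstein_affine; apply: le_bernstein => // k kn.
  by have := gy _ kn; rewrite ler_norml -/(v k); lra.
by rewrite ler_norml; lra.
Qed.

Theorem weierstrass f (a b : R) (e : R) :
  {within `[a, b], continuous f} -> 0 < e ->
  exists p : {poly R}, forall x, x \in `[a, b] -> `|p.[x] - f x| <= e.
Proof.
move=> cf e0; have [ab|ba] := ltP a b; last first.
  exists (f a)%:P => x; rewrite in_itv/= => /andP[ax xb].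
  have -> : x = a by apply/eqP; rewrite eq_le ax (le_trans xb).
  by rewrite hornerC subrr normr0 ltW.
have e20 : 0 < e / 2 by rewrite divr_gt0.
have [d d0 fd] := segment_unif_continuous cf e20.
have [M M0 fM] := segment_bounded cf.
pose w := b - a; have w0 : 0 < w by rewrite subr_gt0.
(* For points at distance at least [d], the crude bound [2 M] on the oscillation is at most
   [K (x - y)^2]. *)
pose K := 2 * M / d ^+ 2; have K0 : 0 <= K.
  by apply: divr_ge0; [exact: mulr_ge0|exact: sqr_ge0].
have fK x y : x \in `[a, b] -> y \in `[a, b] ->
    `|f x - f y| <= e / 2 + K * (x - y) ^+ 2.
  move=> xab yab; have [xy|xy] := ltP `|x - y| d.
    rewrite (le_trans (ltW (fd _ _ xab yab xy)))// lerDl.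
    by rewrite mulr_ge0 ?sqr_ge0.
  rewrite (@le_trans _ _ (2 * M))//.
    by rewrite (le_trans (ler_normB _ _))// mulr2n mulrDl mul1r lerD// fM.
  rewrite (@le_trans _ _ (K * (x - y) ^+ 2))//; last by rewrite lerDr ltW.
  rewrite /K mulrAC ler_pdivlMr ?exprn_gt0// ler_wpM2l ?mulr_ge0//.
  by rewrite -[leRHS]real_normK ?num_real// ler_sqr ?nnegrE// ltW.
(* Rescaled by [w / n] and averaged with a variance of at most [n], the quadratic term contributes
   [K w^2 / n], which this [n] makes at most [e / 2]. *)
pose n := (Num.truncn (K * w ^+ 2 / (e / 2))).+1.
have n0 : 0 < n%:R :> R by rewrite ltr0n.
have nK : K * w ^+ 2 / n%:R <= e / 2.
  rewrite ler_pdivrMr// -ler_pdivrMl// mulrC ltW//.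
  exact: real_truncnS_gt (num_real _).
pose q : {poly R} := w^-1 *: ('X - a%:P).
pose pt (k : nat) : R := a + w * (k%:R / n%:R).
exists (bernstein_poly q n (f \o pt)) => x xab.
rewrite horner_bernstein_poly.
have -> : q.[x] = (x - a) / w by rewrite /q hornerZ hornerXsubC mulrC.
have u01 : 0 <= (x - a) / w <= 1.
  move: xab; rewrite in_itv/= => /andP[ax xb].
  apply/andP; split; first by apply: divr_ge0; rewrite ?(ltW w0)// subr_ge0.
  by rewrite ler_pdivrMr// mul1r lerD2r.
apply: (le_trans (@bernstein_approx _ _ _ _ (e / 2) (K * w ^+ 2 / n%:R ^+ 2) u01 _ _)).
- by apply: divr_ge0; [apply: mulr_ge0 => //|]; exact: sqr_ge0.
- move=> k kn.
  have ptab : pt k \in `[a, b].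
    have kn01 : 0 <= (k%:R / n%:R : R) <= 1.
      apply/andP; split; first exact: divr_ge0.
      by rewrite ler_pdivrMr// mul1r ler_nat.
    by rewrite in_itv/= /pt /w; move: kn01 w0; rewrite /w => /andP[? ?] ?; apply/andP; split; nra.
  rewrite (le_trans (fK _ _ ptab xab))// lerD2l.
  rewrite [leLHS](_ : _ =
    K * w ^+ 2 / n%:R ^+ 2 * (k%:R - n%:R * ((x - a) / w)) ^+ 2)//.
  by rewrite /pt; clearbody K w; field; rewrite !gt_eqF.
rewrite [leRHS](splitr e) lerD2l (le_trans _ nK)// expr2 invfM !mulrA.
by rewrite divfK// gt_eqF.
Qed.

End weierstrass.


(** * Existence and continuity of the functional calculus *)

Section continuous_functional_calculus.
Context (R : realType) (H : hilbertType R).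
Implicit Types (A B X : bop H) (f : R -> R) (p q : {poly R}).

Lemma sa_in_real (I : set R) A z : sa_in I A -> spectrum A z ->
  exists x : R, z = x%:C.
Proof. by move=> [_ AI] /AI[x _ <-]; exists x. Qed.

Lemma sa_in_mem (I : set R) A (x : R) : sa_in I A -> spectrum A x%:C -> I x.
Proof. by move=> [_ AI] /AI[y Iy /(@complexI R) <-]. Qed.

Lemma opnorm_poly_op_sub p q A (I : set R) (e : R) : sa_in I A -> 0 <= e ->
  (forall x : R, spectrum A x%:C -> `|p.[x] - q.[x]| <= e) ->
  opnorm (poly_op p A - poly_op q A) <= e.
Proof.
move=> sA e0 pq; rewrite -poly_opB; apply: opnorm_poly_op => //.
- by case: sA.
- by move=> z; exact: sa_in_real sA.
- by move=> x Ax; rewrite hornerD hornerN; exact: pq.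
Qed.

(** Whatever sequence defines [X], a single polynomial close to [f] on the spectrum controls it. The
    norm bound and the continuity of [cfc] go through this estimate. *)
Lemma is_cfc_dist f A X q (I : set R) (e : R) : sa_in I A -> is_cfc f A X ->
  0 <= e -> (forall x : R, spectrum A x%:C -> `|q.[x] - f x| <= e) ->
  opnorm (poly_op q A - X) <= e.
Proof.
move=> sA [p [pf pX]] e0 qf; apply/ler_addgt0Pr => d d0.
apply: (@rnorm_lim_le _ _ (fun n => poly_op q A - poly_op (p n) A)).
  by apply: cvgB => //; exact: cvg_cst.
apply: filterS (pf _ d0) => n pn; apply: (opnorm_poly_op_sub sA) => [|x Ax].
  by rewrite addr_ge0// ltW.
rewrite (le_trans (ler_distD (f x) _ _))// lerD ?qf//.
by rewrite distrC ltW// pn.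
Qed.

Lemma cfcP f A (a b : R) : sa_in `[a, b] A -> {within `[a, b], continuous f} ->
  is_cfc f A (cfc f A).
Proof.
move=> sA cf; apply: xgetPex.
have pn n : exists p : {poly R}, forall x, x \in `[a, b] ->
    `|p.[x] - f x| <= n.+1%:R^-1 by exact: weierstrass.
have [p pf] := choice pn.
have lim0 (e : R) : 0 < e -> exists N : nat, forall n, (N <= n)%N -> n.+1%:R^-1 < e.
  move=> e0; have [N _ hN] := near_infty_natSinv_lt (PosNum e0).
  by exists N => n Nn; exact: hN.
have [X pX] : exists X : bop H, poly_op (p n) A @[n --> \oo] --> X.
  apply: bop_cauchy_cvg => e e0; have e20 : 0 < e / 2 by rewrite divr_gt0.
  have [N hN] := lim0 _ e20; exists N => m n Nm Nn.
  apply: (opnorm_poly_op_sub sA) => [|x Ax]; first exact: ltW.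
  have xab : x \in `[a, b] by exact: sa_in_mem sA Ax.
  rewrite (le_trans (ler_distD (f x) _ _))// (splitr e) lerD//.
    by rewrite (le_trans (pf _ _ xab))// ltW// hN.
  by rewrite distrC (le_trans (pf _ _ xab))// ltW// hN.
exists X, p; split => // e e0.
have [N hN] := lim0 _ e0; exists N => // n /= Nn x Ax.
by rewrite (le_lt_trans (pf _ _ _))// ?hN//; exact: sa_in_mem sA Ax.
Qed.

Lemma selfadjoint_cfc f A (a b : R) : sa_in `[a, b] A ->
  {within `[a, b], continuous f} -> selfadjoint (cfc f A).
Proof.
move=> sA cf; have [p [_ pX]] := cfcP sA cf.
apply: selfadjoint_lim pX => n; apply: selfadjoint_poly_op.
by case: sA.
Qed.

Lemma opnorm_cfc f A (a b M : R) : sa_in `[a, b] A ->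
  {within `[a, b], continuous f} -> 0 <= M ->
  (forall x, x \in `[a, b] -> `|f x| <= M) -> opnorm (cfc f A) <= M.
Proof.
move=> sA cf M0 fM; have := @is_cfc_dist f A _ 0 _ M sA (cfcP sA cf) M0.
rewrite {1}/poly_op size_poly0 big_ord0 sub0r opnormN; apply=> x Ax.
by rewrite horner0 sub0r normrN fM//; exact: sa_in_mem sA Ax.
Qed.

Lemma cvg_poly_op p (u : nat -> bop H) X : u n @[n --> \oo] --> X ->
  poly_op p (u n) @[n --> \oo] --> poly_op p X.
Proof.
move=> uX; have uXk k : u n ^+ k @[n --> \oo] --> X ^+ k.
  elim: k => [|k IH]; first by rewrite expr0; exact: cvg_cst.
  rewrite exprS; under eq_fun do rewrite exprS.
  exact: bop_cvgM.
rewrite /poly_op; elim: (size p) => [|N IH].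
  by rewrite big_ord0; under eq_fun do rewrite big_ord0; exact: cvg_cst.
rewrite big_ord_recr/=; under eq_fun do rewrite big_ord_recr/=.
by apply: cvgD => //; apply: cvgZ => //; exact: cvg_cst.
Qed.

(** An [e / 3] argument: one polynomial close to [f] on [[a, b]] serves all the operators at once,
    whence the common compact segment for their spectra. *)
Lemma cvg_cfc f (a b : R) (u : nat -> bop H) X :
  {within `[a, b], continuous f} -> (forall n, sa_in `[a, b] (u n)) ->
  sa_in `[a, b] X -> u n @[n --> \oo] --> X ->
  cfc f (u n) @[n --> \oo] --> cfc f X.
Proof.
move=> cf su sX uX; apply/rnorm_cvgP/cvgrPdist_le => e e0.
have e30 : 0 < e / 3 by rewrite divr_gt0.
have [p pf] := weierstrass cf e30.
have /rnorm_cvgP/cvgrPdist_le/(_ _ e30) := cvg_poly_op (p := p) uX.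
apply: filterS => n; rewrite !sub0r !normrN.
rewrite !ger0_norm ?rnorm_ge0// !rnorm_bop => pn.
have fp (Y : bop H) : sa_in `[a, b] Y -> opnorm (poly_op p Y - cfc f Y) <= e / 3.
  move=> sY; apply: (is_cfc_dist sY (cfcP sY cf) (ltW e30)) => x Yx.
  by apply: pf; exact: sa_in_mem sY Yx.
rewrite (le_trans (opnormB_le _ _ (poly_op p (u n))))//.
have := opnormB_le (poly_op p (u n)) (cfc f X) (poly_op p X).
have := fp _ (su n); rewrite opnormBC; have := fp _ sX.
by lra.
Qed.

End continuous_functional_calculus.

(** * Spectra along the segment from [A] to [B] *)

Section segment_of_operators.
Context (R : realType) (H : hilbertType R).
Implicit Types (A B X : bop H).

Lemma nabla0 A B : nabla 0 A B = A.
Proof. by rewrite /nabla subr0 scale1r scale0r addr0. Qed.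

Lemma nabla1 A B : nabla 1 A B = B.
Proof. by rewrite /nabla subrr scale0r scale1r add0r. Qed.

Lemma nabla_nabla A B (s t u : R) :
  nabla s (nabla t A B) (nabla u A B) = nabla ((1 - s) * t + s * u) A B.
Proof.
rewrite /nabla !scalerDr !scalerA addrACA -!scalerDl -!rmorphM -!rmorphD/=.
by congr (_%:C *: _ + _%:C *: _); ring.
Qed.

Lemma cvg_nabla A B (t : nat -> R) (s : R) : t n @[n --> \oo] --> s ->
  nabla (t n) A B @[n --> \oo] --> nabla s A B.
Proof.
move=> ts; apply: (@rnorm_squeeze _ _ _ _ (fun n => `|t n - s| * opnorm (B - A))).
  move=> n; suff -> : nabla (t n) A B - nabla s A B = (t n - s)%:C *: (B - A).
    by rewrite rnorm_bop opnormZ.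
  rewrite /nabla opprD addrACA -!scalerBl -!rmorphB/=.
  have -> : 1 - t n - (1 - s) = - (t n - s) by ring.
  by rewrite rmorphN/= scaleNr scalerBr addrC.
rewrite -(mul0r (opnorm (B - A))); apply: cvgM; last exact: cvg_cst.
by rewrite -(normr0 R); apply: cvg_norm; rewrite -(subrr s); apply: cvgB => //; exact: cvg_cst.
Qed.

(** For a self-adjoint operator, having spectrum in [[a, b]] amounts to a norm bound around the
    midpoint by the half length, and that bound passes to convex combinations. *)
Lemma sa_in_nabla (I : set R) A B : (1 : bop H) <> 0 -> is_interval I ->
  sa_in I A -> sa_in I B -> exists a b : R, [/\ `[a, b] `<=` I &
  forall t, 0 <= t <= 1 -> sa_in `[a, b] (nabla t A B)].
Proof.
move=> nt itvI sA sB.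
have [a1 [b1 [Ia1 Ib1 Aab]]] := spectrum_hull nt sA.
have [a2 [b2 [Ia2 Ib2 Bab]]] := spectrum_hull nt sB.
pose a := Num.min a1 a2; pose b := Num.max b1 b2.
have Ia : I a by rewrite /a /Num.min; case: ifP.
have Ib : I b by rewrite /b /Num.max; case: ifP.
exists a, b; split.
  by move=> x /=; rewrite in_itv/= => xab; exact: (itvI a b).
move=> t /andP[t0 t1]; set c := (a + b) / 2; set r := (b - a) / 2.
have nA : opnorm (A - c%:C *: (1 : bop H)) <= r.
  apply: opnorm_center => //; first by case: sA.
  by move=> x /Aab/andP[? ?]; rewrite ge_min le_max; apply/andP; split; apply/orP; left.
have nB : opnorm (B - c%:C *: (1 : bop H)) <= r.
  apply: opnorm_center => //; first by case: sB.
  by move=> x /Bab/andP[? ?]; rewrite ge_min le_max; apply/andP; split; apply/orP; right.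
have st : selfadjoint (nabla t A B).
  by apply: selfadjointD; apply: selfadjointZ; [case: sA|case: sB].
split=> // z; have : opnorm (nabla t A B - c%:C *: (1 : bop H)) <= r.
  have -> : nabla t A B - c%:C *: (1 : bop H) =
      (1 - t)%:C *: (A - c%:C *: (1 : bop H)) + t%:C *: (B - c%:C *: (1 : bop H)).
    rewrite !scalerBr !scalerA addrACA; congr (_ + _).
    by rewrite -opprD -scalerDl -!rmorphM -rmorphD/= -mulrDl subrK mul1r.
  rewrite (le_trans (opnormD _ _))// !opnormZ ger0_norm ?subr_ge0//.
  rewrite ger0_norm//.
  have := ler_wpM2l t0 nB; have t10 : 0 <= 1 - t by rewrite subr_ge0.
  by have := ler_wpM2l t10 nA; lra.
move=> nr /(spectrum_ball st nr)[x -> xr]; exists x => //=.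
by rewrite in_itv/=; move: xr; rewrite /c /r => /andP[? ?]; apply/andP; split; lra.
Qed.

End segment_of_operators.


Lemma dist_squeeze (R : realType) (u e : nat -> R) (l : R) :
  (forall n, `|u n - l| <= e n) -> e n @[n --> \oo] --> (0 : R) ->
  u n @[n --> \oo] --> l.
Proof.
move=> ue /cvgrPdist_le e0; apply/cvgrPdist_le => r /e0; apply: filterS => n.
rewrite sub0r normrN distrC => er.
by rewrite (le_trans (ue n))// (le_trans (ler_norm _)).
Qed.

(** * Bounded functions on a domain of finite measure *)

Section bounded_on_finite_measure.
Context (d : measure_display) (T : measurableType d) (R : realType).
Variables (mu : {measure set T -> \bar R}) (D : set T).
Hypotheses (mD : measurable D) (muD : (mu D < +oo)%E).
Implicit Types f : T -> R.

Lemma le_bounded_integrable f (M : R) : measurable_fun D f ->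
  (forall t, D t -> `|f t| <= M) -> mu.-integrable D (EFin \o f).
Proof.
move=> mf fM; apply: measurable_bounded_integrable => //.
exists M; split; first exact: num_real.
by move=> x Mx t Dt /=; rewrite (le_trans (fM _ Dt))// ltW.
Qed.

Lemma Rintegral_dominated (f_ : nat -> T -> R) f (g : T -> R) :
  (forall n, measurable_fun D (f_ n)) ->
  (forall t, D t -> f_ n t @[n --> \oo] --> f t) ->
  mu.-integrable D (EFin \o g) ->
  (forall n t, D t -> `|f_ n t| <= g t) ->
  \int[mu]_(t in D) f_ n t @[n --> \oo] --> \int[mu]_(t in D) f t.
Proof.
move=> mf cf ig fg.
have mlim : measurable_fun D f by exact: (measurable_fun_cvg mf cf).
have [] := @dominated_convergence _ _ _ mu D mD (fun n t => (f_ n t)%:E)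
  (EFin \o f) (EFin \o g).
- by move=> n; exact/measurable_EFinP.
- exact/measurable_EFinP.
- by apply: aeW => t Dt; apply/cvg_EFin; [exact: nearW|exact: cf].
- exact: ig.
- by apply: aeW => t n Dt; rewrite /= lee_fin fg.
move=> intf _ c; apply: fine_cvg; rewrite fineK; first exact: c.
exact: integrable_fin_num.
Qed.

Lemma cst_integrable (c : R) : mu.-integrable D (EFin \o cst c).
Proof. by apply: (@le_bounded_integrable _ `|c|). Qed.

Lemma Rintegral_sum (I : Type) (r : seq I) (P : pred I) (f : I -> T -> R) :
  (forall i, mu.-integrable D (EFin \o f i)) ->
  \int[mu]_(t in D) (\sum_(i <- r | P i) f i t) =
  \sum_(i <- r | P i) \int[mu]_(t in D) f i t.
Proof.
move=> intf.
have intS s : mu.-integrable D (EFin \o (fun t => \sum_(i <- s | P i) f i t)).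
  have -> : EFin \o (fun t => \sum_(i <- s | P i) f i t) =
      (fun t => \sum_(i <- s | P i) (f i t)%:E)%E.
    by apply/funext => t /=; rewrite sumEFin.
  by apply: integrable_sum => // i _; exact: intf.
elim: r => [|i r IH].
  rewrite big_nil (@eq_Rintegral _ _ _ mu D (cst 0)).
    by rewrite Rintegral_cst// mul0r.
  by move=> t _; rewrite big_nil.
rewrite big_cons; case: ifPn => Pi.
  rewrite -IH -RintegralD//; apply: eq_Rintegral => t _.
  by rewrite big_cons Pi.
by rewrite -IH; apply: eq_Rintegral => t _; rewrite big_cons (negbTE Pi).
Qed.

End bounded_on_finite_measure.

(** * Maps with finitely many values *)

Section simple_maps.
Context (d : measure_display) (T : measurableType d) (R : realType).

Definition simple_map (U : Type) (s : T -> U) :=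
  finite_set (range s) /\ forall v, measurable (s @^-1` [set v]).

(** A preimage is a finite union of level sets, so operator-valued maps are handled with no
    sigma-algebra on the operators. *)
Lemma simple_map_preimage (U : choiceType) (s : T -> U) (Y : set U) :
  simple_map s -> measurable (s @^-1` Y).
Proof.
move=> [fs ms]; have -> : s @^-1` Y = \bigcup_(v in range s `&` Y) s @^-1` [set v].
  apply/seteqP; split => [t /= Yt|t [v [_ Yv] /= ->//]].
  by exists (s t) => //; split => //; exists t.
apply: fin_bigcup_measurable => [|v _]; last exact: ms.
exact: finite_setIl.
Qed.

Lemma simple_map_measurable (U : choiceType) (s : T -> U) (h : U -> R) (D : set T) :
  simple_map s -> measurable_fun D (fun t => h (s t)).
Proof.
move=> ss mD Y mY; apply: measurableI => //.
exact: (simple_map_preimage (h @^-1` Y) ss).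
Qed.

Lemma simple_map_pair (U V : choiceType) (s : T -> U) (s' : T -> V) :
  simple_map s -> simple_map s' -> simple_map (fun t => (s t, s' t)).
Proof.
move=> [fs ms] [fs' ms']; split.
  apply: sub_finite_set (finite_setX fs fs') => _ [t _ <-].
  by split => /=; exists t.
move=> [u v]; have -> : (fun t => (s t, s' t)) @^-1` [set (u, v)] =
    s @^-1` [set u] `&` s' @^-1` [set v].
  by apply/seteqP; split => [t /= [-> ->]//|t /= [-> ->]].
by apply: measurableI.
Qed.

Lemma simple_map_comp (U V : choiceType) (s : T -> U) (h : U -> V) :
  simple_map s -> simple_map (fun t => h (s t)).
Proof.
move=> ss; split; last by move=> v; exact: (simple_map_preimage (h @^-1` [set v])).
case: ss => fs _.
have -> : range (fun t => h (s t)) = h @` range s.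
  by rewrite -[LHS]/(range (h \o s)) image_comp.
exact: finite_image.
Qed.

Lemma simple_map_bounded (U : choiceType) (s : T -> U) (h : U -> R) :
  simple_map s -> exists M, forall t, `|h (s t)| <= M.
Proof.
move=> [fs _]; pose r := [seq `|h v| | v <- fset_set (range s)].
exists (\sum_(i <- r) i) => t.
have : s t \in fset_set (range s) by rewrite in_fset_set//; apply/mem_set; exists t.
rewrite big_map => str; rewrite (big_rem (s t))//= lerDl.
by apply: sumr_ge0.
Qed.

(** The weight [w] is the constant 1 when integrating a simple map, and a density when two measures
    are compared. *)
Lemma Rintegral_simple_mul (mu : {measure set T -> \bar R}) (D : set T)
    (U : choiceType) (s : T -> U) (h : U -> R) (w : T -> R) :
  measurable D -> simple_map s -> mu.-integrable D (EFin \o w) ->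
  \int[mu]_(t in D) (h (s t) * w t) =
  \sum_(v <- fset_set (range s)) h v * \int[mu]_(t in D `&` s @^-1` [set v]) w t.
Proof.
move=> mD [fs ms] intw.
have intv v : mu.-integrable D (EFin \o (w \* \1_(s @^-1` [set v]))).
  rewrite (_ : EFin \o _ = ((EFin \o w) \* (EFin \o \1_(s @^-1` [set v])))%E)//.
  apply: (integrableMl mD intw); first exact: measurable_indic.
  exists 1; split=> // x x1 t _ /=; rewrite (le_trans _ (ltW x1))// indicE.
  by case: (_ \in _); rewrite ?normr0 ?normr1.
transitivity (\int[mu]_(t in D)
    \sum_(v <- fset_set (range s)) (h v * (w t * \1_(s @^-1` [set v]) t))).
  apply: eq_Rintegral => t _.
  have str : s t \in fset_set (range s).
    by rewrite in_fset_set//; apply/mem_set; exists t.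
  rewrite (big_rem (s t))//= big_seq big1 ?addr0.
    by rewrite indicE mem_set// mulr1.
  move=> v; rewrite mem_rem_uniq ?fset_uniq// => /andP[/= vs _].
  by rewrite indicE memNset ?mulr0//= => stv; rewrite stv eqxx in vs.
rewrite Rintegral_sum//; last first.
  move=> v; rewrite (_ : _ \o _ =
    fun t => ((h v)%:E * (w t * \1_(s @^-1` [set v]) t)%:E)%E).
    exact: (integrableZl mD (h v) (intv v)).
  by apply/funext => t /=; rewrite EFinM.
apply: eq_bigr => v _; rewrite (RintegralZl _ mD (intv v)); congr (_ * _).
rewrite Rintegral_mkcondr; apply: eq_Rintegral => t _.
by rewrite /= indicE patchE; case: (_ \in _); rewrite ?mulr1 ?mulr0.
Qed.

End simple_maps.

(** * Existence and weak evaluation of Bochner integrals *)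

Section bochner_integral_of_operators.
Context (d : measure_display) (T : measurableType d) (R : realType).
Context (H : hilbertType R).
Variables (mu : {measure set T -> \bar R}) (D : set T).
Hypotheses (mD : measurable D) (muD : (mu D < +oo)%E).
Implicit Types (F s : T -> bop H) (X : bop H) (x y : H).

Lemma simple_map_integrable s (h : bop H -> R) : simple_map s ->
  mu.-integrable D (EFin \o (fun t => h (s t))).
Proof.
move=> ss; have [M hM] := simple_map_bounded h ss.
by apply: (@le_bounded_integrable _ _ _ _ _ _ _ _ M) => //;
  exact: simple_map_measurable.
Qed.

Lemma simple_map_simple_integrable s : simple_map s -> simple_integrable mu D s.
Proof.
move=> [fs ms]; split=> // v _; apply: le_lt_trans muD.
by apply: le_measure => //; apply/mem_set => //; exact: measurableI.
Qed.

Lemma rip_simple_integral s x y : simple_map s ->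
  rip (simple_integral mu D s x) y = \int[mu]_(t in D) rip (s t x) y.
Proof.
move=> [fs ms]; rewrite /simple_integral fsbig_finite//=.
pose l (v : bop H) := rip (v x) y.
have lE (r : seq (bop H)) (c : bop H -> R) :
    l (\sum_(v <- r) (c v)%:C *: v) = \sum_(v <- r) c v * l v.
  elim: r => [|v r IH]; first by rewrite !big_nil /l bop0E -(scale0r 0) ripZl mul0r.
  by rewrite !big_cons -IH /l bopDE ripDl bopZE ripZl.
rewrite -[LHS]/(l _) lE.
rewrite (@eq_Rintegral _ _ _ mu D (fun t => l (s t) * cst 1 t)); last first.
  by move=> t _; rewrite mulr1.
rewrite (Rintegral_simple_mul l mD (conj fs ms)); last exact: cst_integrable.
apply: eq_bigr => v _; rewrite mulrC Rintegral_cst ?mul1r//.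
exact: measurableI.
Qed.

(** No measure occurs here: the same approximants serve Lebesgue measure and every [eta_measure l],
    and the uniform bound feeds dominated convergence. *)
Definition simply_approximable F := exists s : nat -> T -> bop H,
  [/\ forall n, simple_map (s n),
      forall t, D t -> s n t @[n --> \oo] --> F t &
      exists K, forall n t, D t -> opnorm (s n t) <= K].

Section approximable.
Variable F : T -> bop H.
Hypothesis aF : simply_approximable F.

Lemma approximable_bounded : exists K, forall t, D t -> opnorm (F t) <= K.
Proof.
have [s [_ sF [K sK]]] := aF; exists K => t Dt.
by apply: (rnorm_lim_le (sF _ Dt)); apply: nearW => n; exact: sK.
Qed.

Lemma approximable_measurable_rip x y : measurable_fun D (fun t => rip (F t x) y).
Proof.
have [s [ss sF _]] := aF.
apply: (@measurable_fun_cvg _ _ _ _ (fun n t => rip (s n t x) y)).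
  by move=> n; exact: (simple_map_measurable (fun v : bop H => rip (v x) y)).
move=> t Dt; have /rnorm_cvgP st := sF _ Dt.
apply: (@dist_squeeze _ _ (fun n => opnorm (s n t - F t) * (rnorm x * rnorm y))).
  by move=> n; rewrite -ripBl -bopBE rip_opnorm.
by rewrite -(mul0r (rnorm x * rnorm y)); apply: cvgM => //; exact: cvg_cst.
Qed.

Lemma approximable_measurable_dist s : simple_map s ->
  measurable_fun D (fun t => opnorm (F t - s t)).
Proof.
move=> ss; have [u [su uF _]] := aF.
apply: (@measurable_fun_cvg _ _ _ _ (fun n t => opnorm (u n t - s t))).
  move=> n; exact: (@simple_map_measurable _ _ _ _ _
    (fun v : bop H * bop H => opnorm (v.1 - v.2)) D (simple_map_pair (su n) ss)).
move=> t Dt; have /rnorm_cvgP ut := uF _ Dt.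
apply: (dist_squeeze _ ut) => n; rewrite ler_norml rnorm_bop.
have := opnormB_le (u n t) (s t) (F t); have := opnormB_le (F t) (s t) (u n t).
by rewrite (opnormBC (F t) (u n t)) => ? ?; apply/andP; split; lra.
Qed.

Lemma approximable_integrable_rip x y :
  mu.-integrable D (EFin \o (fun t => rip (F t x) y)).
Proof.
have [K FK] := approximable_bounded.
apply: (@le_bounded_integrable _ _ _ _ _ mD muD _ (K * (rnorm x * rnorm y))).
  exact: approximable_measurable_rip.
move=> t Dt; rewrite (le_trans (rip_opnorm _ _ _))//.
by rewrite ler_wpM2r ?FK// mulr_ge0 ?rnorm_ge0.
Qed.

Lemma approximable_integrable_dist s : simple_map s ->
  mu.-integrable D (EFin \o (fun t => opnorm (F t - s t))).
Proof.
move=> ss; have [K FK] := approximable_bounded.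
have [M sM] := simple_map_bounded (@opnorm R H) ss.
apply: (@le_bounded_integrable _ _ _ _ _ mD muD _ (K + M)).
  exact: approximable_measurable_dist.
move=> t Dt; rewrite ger0_norm ?opnorm_ge0// (le_trans (opnormD _ _))//.
by rewrite opnormN lerD ?FK// (le_trans (ler_norm _)).
Qed.

Lemma rip_simple_integral_dist s x y : simple_map s ->
  `|rip (simple_integral mu D s x) y - \int[mu]_(t in D) rip (F t x) y| <=
  (\int[mu]_(t in D) opnorm (F t - s t)) * (rnorm x * rnorm y).
Proof.
move=> ss; have int_s := simple_map_integrable (fun v : bop H => rip (v x) y) ss.
have int_F := approximable_integrable_rip x y.
have int_d := approximable_integrable_dist ss.
rewrite rip_simple_integral// -RintegralB//.
rewrite (le_trans (le_normr_Rintegral _ _))//.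
  rewrite (_ : EFin \o _ = fun t => ((rip (s t x) y)%:E - (rip (F t x) y)%:E)%E)//.
  exact: (integrableB mD int_s int_F).
have int_sF : mu.-integrable D (EFin \o (fun t => rip (s t x) y - rip (F t x) y)).
  rewrite (_ : EFin \o _ = fun t => ((rip (s t x) y)%:E - (rip (F t x) y)%:E)%E)//.
  exact: (integrableB mD int_s int_F).
rewrite -RintegralZr//; apply: le_Rintegral => //.
- exact: integrable_norm int_sF.
- rewrite (_ : EFin \o _ = fun t =>
    ((opnorm (F t - s t))%:E * (rnorm x * rnorm y)%:E)%E)//.
  exact: (integrableZr mD _ int_d).
- by move=> t Dt; rewrite -ripBl -bopBE opnormBC rip_opnorm.
Qed.

(** Both sides are limits of the same scalar sequence. Since [rip] separates operators, the value
    selected by [xget] does not depend on the approximants. *)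
Lemma is_bochner_rip X x y : is_bochner mu D F X ->
  rip (X x) y = \int[mu]_(t in D) rip (F t x) y.
Proof.
move=> [s [si _ sF sX]].
have ss n : simple_map (s n) by case: (si n).
have /fine_cvg e0 := sF.
have lim1 : rip (simple_integral mu D (s n) x) y @[n --> \oo] --> rip (X x) y.
  have /rnorm_cvgP cX := sX.
  apply: (@dist_squeeze _ _
    (fun n => opnorm (simple_integral mu D (s n) - X) * (rnorm x * rnorm y))).
    by move=> n; rewrite -ripBl -bopBE rip_opnorm.
  by rewrite -(mul0r (rnorm x * rnorm y)); apply: cvgM => //; exact: cvg_cst.
have lim2 : rip (simple_integral mu D (s n) x) y @[n --> \oo] -->
    \int[mu]_(t in D) rip (F t x) y.
  apply: (dist_squeeze (fun n => rip_simple_integral_dist x y (ss n))).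
  by rewrite -(mul0r (rnorm x * rnorm y)); apply: cvgM; [exact: e0|exact: cvg_cst].
exact: (@cvg_unique _ (@Rhausdorff R) _ _ _ _ lim1 lim2).
Qed.

Lemma approximable_is_bochner : exists X : bop H, is_bochner mu D F X.
Proof.
have [s [ss sF [K sK]]] := aF.
have [K' FK] := approximable_bounded.
have to0 : (\int[mu]_(t in D) (opnorm (F t - s n t))%:E @[n --> \oo] --> 0)%E.
  have [] := @dominated_convergence _ _ _ mu D mD
    (fun n t => (opnorm (F t - s n t))%:E) (cst 0%E) (EFin \o cst (K' + K)).
  - move=> n; apply/measurable_EFinP; exact: approximable_measurable_dist.
  - exact: measurable_cst.
  - apply: aeW => t Dt; apply/cvg_EFin; first exact: nearW.
    have /rnorm_cvgP := sF _ Dt.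
    by under eq_fun do rewrite rnormBC.
  - exact: cst_integrable.
  - apply: aeW => t n Dt; rewrite /= lee_fin ger0_norm ?opnorm_ge0//.
    by rewrite (le_trans (opnormD _ _))// opnormN lerD ?FK ?sK.
  by move=> _ _; rewrite integral0.
have /fine_cvg e0 := to0.
have [X sX] : exists X : bop H, simple_integral mu D (s n) @[n --> \oo] --> X.
  apply: bop_cauchy_cvg => e ep; have e20 : 0 < e / 2 by rewrite divr_gt0.
  have /cvgrPdist_le/(_ _ e20)[N _ hN] := e0; exists N => m n Nm Nn.
  have le2 k : (N <= k)%N -> \int[mu]_(t in D) opnorm (F t - s k t) <= e / 2.
    by move=> /hN /=; rewrite sub0r normrN => /(le_trans (ler_norm _)).
  (* The Cauchy property is tested weakly: both simple integrals are compared with the scalar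
     integral of [F], uniformly over [x] and [y]. *)
  apply: opnorm_rip_le => [|x y]; first exact: ltW.
  rewrite bopBE ripBl.
  rewrite (le_trans (ler_distD (\int[mu]_(t in D) rip (F t x) y) _ _))//.
  rewrite (splitr e) mulrDl lerD//.
    rewrite (le_trans (rip_simple_integral_dist _ _ (ss m)))//.
    by rewrite ler_wpM2r ?le2// mulr_ge0 ?rnorm_ge0.
  rewrite distrC (le_trans (rip_simple_integral_dist _ _ (ss n)))//.
  by rewrite ler_wpM2r ?le2// mulr_ge0 ?rnorm_ge0.
exists X, s; split=> // [n|]; first exact: simple_map_simple_integrable.
by apply: aeW => t Dt; exact: sF.
Qed.

Lemma bochner_rip x y :
  rip (bochner mu D F x) y = \int[mu]_(t in D) rip (F t x) y.
Proof. by apply: is_bochner_rip; apply: xgetPex; exact: approximable_is_bochner. Qed.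

(** On simple maps the change of measure is the hypothesis on [nu], applied to each level set;
    dominated convergence under both measures extends it to [F]. *)
Lemma approximable_density (nu : {measure set T -> \bar R}) (p : T -> R) x y :
  mu.-integrable D (EFin \o p) -> (forall t, D t -> 0 <= p t) ->
  (forall U, measurable U -> U `<=` D -> nu U = \int[mu]_(t in U) (p t)%:E)%E ->
  (\int[nu]_(t in D) rip (F t x) y)%R = \int[mu]_(t in D) (rip (F t x) y * p t).
Proof.
move=> intp p0 nuE; have [s [ss sF [K sK]]] := aF.
have nuD : (nu D < +oo)%E.
  by rewrite nuE// -ge0_fin_numE ?integral_ge0//; exact: integrable_fin_num.
pose M := K * (rnorm x * rnorm y).
have sM n t : D t -> `|rip (s n t x) y| <= M.
  move=> Dt; rewrite (le_trans (rip_opnorm _ _ _))//.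
  by rewrite ler_wpM2r ?sK// mulr_ge0 ?rnorm_ge0.
have rip_cvg t : D t -> rip (s n t x) y @[n --> \oo] --> rip (F t x) y.
  move=> Dt; have /rnorm_cvgP st := sF _ Dt.
  apply: (@dist_squeeze _ _ (fun n => opnorm (s n t - F t) * (rnorm x * rnorm y))).
    by move=> n; rewrite -ripBl -bopBE rip_opnorm.
  by rewrite -(mul0r (rnorm x * rnorm y)); apply: cvgM => //; exact: cvg_cst.
have mrip n : measurable_fun D (fun t => rip (s n t x) y).
  exact: (simple_map_measurable (fun v : bop H => rip (v x) y)).
have mp : measurable_fun D p by apply/measurable_EFinP/(measurable_int mu).
have lim1 : \int[nu]_(t in D) rip (s n t x) y @[n --> \oo] -->
    \int[nu]_(t in D) rip (F t x) y.
  by apply: (@Rintegral_dominated _ _ _ nu D mD _ _ (cst M)) => //;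
    exact: cst_integrable.
have lim2 : \int[mu]_(t in D) (rip (s n t x) y * p t) @[n --> \oo] -->
    \int[mu]_(t in D) (rip (F t x) y * p t).
  apply: (@Rintegral_dominated _ _ _ mu D mD _ _ (fun t => M * p t)).
  - by move=> n; exact: measurable_funM.
  - by move=> t Dt; apply: cvgM; [exact: rip_cvg|exact: cvg_cst].
  - exact: (integrableZl mD M intp).
  - move=> n t Dt; rewrite normrM (ger0_norm (p0 _ Dt)).
    by rewrite ler_wpM2r ?p0// sM.
have eqn n : \int[nu]_(t in D) rip (s n t x) y =
    \int[mu]_(t in D) (rip (s n t x) y * p t).
  rewrite (Rintegral_simple_mul (fun v : bop H => rip (v x) y) mD (ss n) intp).
  rewrite (@eq_Rintegral _ _ _ nu D (fun t => rip (s n t x) y * cst 1 t)); last first.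
    by move=> t _; rewrite mulr1.
  rewrite (Rintegral_simple_mul (fun v : bop H => rip (v x) y) mD (ss n)); last first.
    exact: cst_integrable.
  have [_ ms] := ss n; apply: eq_bigr => v _; congr (_ * _).
  have mDv : measurable (D `&` s n @^-1` [set v]) by exact: measurableI.
  by rewrite Rintegral_cst// mul1r nuE.
rewrite (funext eqn) in lim1.
exact: (@cvg_unique _ (@Rhausdorff R) _ _ _ _ lim1 lim2).
Qed.

End approximable.

End bochner_integral_of_operators.


Lemma max_dist_le (R : realType) (g h t : R) : 0 <= t -> 0 <= h ->
  `|Num.max g h - t| <= `|g - t| + h.
Proof.
move=> t0 h0; have := ler_norm (t - g); rewrite distrC => tg.
rewrite maxEge; case: ifPn => [_|]; first by rewrite lerDl.
by rewrite -ltNge => gh; rewrite ler_norml; have := normr_ge0 (g - t); lra.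
Qed.

(** * Simple approximants of norm continuous maps *)

Section sequentially_continuous_approximable.
Import HBNNSimple.
Context (R : realType) (H : hilbertType R).

(* The sample points [max (g_n t) (n+2)^-1], with [g_n] increasing to the identity,
   never leave an interval with endpoints 0 and 1, whether or not it is open. *)
Lemma seq_continuous_approximable (D : set (measurableTypeR R)) (F : R -> bop H)
    (K : R) :
  measurable D -> D `<=` `[0, 1] ->
  (forall t v, D t -> 0 < v <= Num.max t 2^-1 -> D v) ->
  (forall t, D t -> opnorm (F t) <= K) ->
  (forall t (u : nat -> R), D t -> (forall n, D (u n)) ->
    u n @[n --> \oo] --> t -> F (u n) @[n --> \oo] --> F t) ->
  simply_approximable D F.
Proof.
move=> mD D01 Ddown FK cF.
have mid : measurable_fun D (EFin \o @id (measurableTypeR R)).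
  by apply/measurable_EFinP; exact: measurable_id.
pose g := nnsfun_approx mD mid.
pose q n (t : R) : R := Num.max (g n t) n.+2%:R^-1.
have gcvg t : D t -> g n t @[n --> \oo] --> t.
  move=> Dt; apply: (@fine_cvg _ _ _ _ (fun n => (g n t)%:E)).
  apply: cvg_nnsfun_approx => // x Dx; rewrite lee_fin.
  by have := D01 _ Dx; rewrite /= in_itv/= => /andP[].
have gle n t : D t -> g n t <= t.
  move=> Dt; have gt := gcvg _ Dt.
  have nd : nondecreasing_seq (fun n => g n t : R).
    by move=> m k mk; exact/lefP/nd_nnsfun_approx.
  have cg : cvgn (fun n => g n t : R) by apply/cvg_ex; exists t.
  have := nondecreasing_cvgn_le nd cg n.
  by rewrite (cvg_lim (@Rhausdorff R) gt).
(* The offset in [n.+2] keeps the lower cutoff at most [2^-1], hence inside []0, 1[] already for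
   [n = 0]. *)
have qD n t : D t -> D (q n t).
  move=> Dt; apply: (Ddown t) => //; rewrite /q lt_max invr_gt0 ltr0n orbT/=.
  rewrite ge_max !le_max gle//= lef_pV2 ?posrE// ler_nat.
  by rewrite !orbT.
have qcvg t : D t -> q n t @[n --> \oo] --> t.
  move=> Dt; have t0 : 0 <= t by have := D01 _ Dt; rewrite /= in_itv/= => /andP[].
  have h0 : (n.+2%:R^-1 : R) @[n --> \oo] --> (0 : R).
    by rewrite (@cvg_shiftS R (fun n => n.+1%:R^-1)); exact: cvg_harmonic.
  apply: (@dist_squeeze _ _ (fun n => `|g n t - t| + n.+2%:R^-1)).
    by move=> n; apply: max_dist_le; rewrite ?invr_ge0.
  rewrite -[X in _ --> X]addr0 -{1}(normr0 R) -{1}(subrr t); apply: cvgD => //.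
  by apply: cvg_norm; apply: cvgB; [exact: gcvg|exact: cvg_cst].
have sq n : simple_map (fun t => F (q n t)).
  apply: (@simple_map_comp _ (measurableTypeR R) _ _ (g n)
    (fun v : R => F (Num.max v n.+2%:R^-1))).
  by split; [exact: fimfunP|move=> v; exact: measurable_sfunP].
exists (fun n t => F (q n t)); split=> // [t Dt|].
  by apply: cF => // [n|]; [exact: qD|exact: qcvg].
by exists K => n t Dt; apply: FK; exact: qD.
Qed.

End sequentially_continuous_approximable.

(** * The densities of the measures [eta_l] *)

Section eta_density.
Context (R : realType).
Local Notation mu := (@lebesgue_measure R).
Implicit Types (a l t : R).

(** The exponent [a - 1] may be negative, so the fundamental theorem of calculus is applied on
    [[1 / (n + 2), 1]], where [t^a] is a primitive, and monotone convergence reaches 0. *)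
Lemma integral_powR01 a : 0 < a ->
  (\int[mu]_(t in `[0%R, 1%R]) (a * t `^ (a - 1))%:E = 1)%E.
Proof.
move=> a0; pose h t : R := a * t `^ (a - 1).
have mh (D : set (measurableTypeR R)) : measurable_fun D (EFin \o h).
  apply/measurable_EFinP; apply: measurable_funM => //.
  by apply: measurable_funTS; exact: measurable_powR.
pose A n : set (measurableTypeR R) := `[n.+2%:R^-1, 1]%classic.
have n20 n : 0 < n.+2%:R^-1 :> R by rewrite invr_gt0.
have intA n : (\int[mu]_(t in A n) (h t)%:E = (1 - n.+2%:R^-1 `^ a)%:E)%E.
  rewrite /A (@continuous_FTC2 _ h (fun t : R => t `^ a)).
  - by rewrite powR1 EFinB.
  - by rewrite invf_lt1// ltr1n.
  - apply: derivable_within_continuous => t; rewrite in_itv/= => /andP[nt _].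
    apply: derivableM => //; apply: derivable_powR.
    by rewrite in_itv/= andbT (lt_le_trans (n20 n)).
  - have dP (t : R) : 0 < t -> derivable (fun t : R => t `^ a) t 1.
      by move=> t0; apply: derivable_powR; rewrite in_itv/= andbT.
    have cP (t : R) : 0 < t -> {for t, continuous (fun t : R => t `^ a)}.
      by move=> /dP /derivable1_diffP /differentiable_continuous.
    split.
    + move=> t; rewrite in_itv/= => /andP[nt _]; apply: dP.
      exact: lt_trans nt.
    + by apply: cvg_at_right_filter; exact: cP.
    + by apply: cvg_at_left_filter; exact: cP.
  - move=> t; rewrite in_itv/= => /andP[nt _].
    by rewrite powR_derive1// in_itv/= andbT (lt_trans (n20 n)).
have bigA : \bigcup_n A n = `]0, 1]%classic.
  apply/seteqP; split => [t [n _]|t] /=.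
    rewrite /A/= !in_itv/= => /andP[nt t1].
    by rewrite t1 (lt_le_trans (n20 n)).
  rewrite in_itv/= => /andP[t0 t1].
  have [N _ hN] := near_infty_natSinv_lt (PosNum t0); exists N => //.
  rewrite /A/= in_itv/= t1 andbT ltW// (le_lt_trans _ (hN N (leqnn N)))//.
  by rewrite lef_pV2 ?posrE// ler_nat.
have lim1 : (\int[mu]_(t in A n) (h t)%:E @[n --> \oo] -->
    \int[mu]_(t in `]0%R, 1%R]) (h t)%:E)%E.
  rewrite -bigA; apply: ge0_nondecreasing_set_cvg_integral => //.
  - move=> m n mn; rewrite subsetEset => t; rewrite /A/= !in_itv/= => /andP[mt t1].
    by rewrite t1 andbT (le_trans _ mt)// lef_pV2 ?posrE// ler_nat.
  - by move=> n; exact: measurable_itv.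
  - by move=> n t _; rewrite lee_fin mulr_ge0 ?powR_ge0// ltW.
have lim2 : (\int[mu]_(t in A n) (h t)%:E @[n --> \oo] --> 1)%E.
  rewrite (funext intA); apply: cvg_EFin; first exact: nearW.
  rewrite -[X in _ --> X]subr0; apply: cvgB; first exact: cvg_cst.
  have /cvg_at_rightP := powR_cvg0 a0; apply; split=> //.
  by rewrite (@cvg_shiftS R (fun n => n.+1%:R^-1)); exact: cvg_harmonic.
rewrite -integral_itv_obnd_cbnd; last exact: mh.
exact: (@cvg_unique _ (@ereal_hausdorff R) _ _ _ _ lim1 lim2).
Qed.

(** Since [(2 l - 1) / (1 - l) = odds l - 1], [eta_l] is the Beta law with parameters [odds l] and
    1. *)
Definition odds l := l / (1 - l).

Lemma odds_gt0 l : 0 < l < 1 -> 0 < odds l.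
Proof. by move=> /andP[l0 l1]; rewrite divr_gt0// subr_gt0. Qed.

Lemma eta_pdfE l t : 0 < l < 1 -> 0 <= t <= 1 ->
  eta_pdf l t = odds l * t `^ (odds l - 1).
Proof.
move=> l01 t01; rewrite /eta_pdf l01 t01/= /odds; congr (_ * _ `^ _).
by field; rewrite subr_eq0 eq_sym lt_eqF//; case/andP: l01.
Qed.

Lemma integral_eta_pdf l : 0 < l < 1 ->
  (\int[mu]_(t in `[0%R, 1%R]) (eta_pdf l t)%:E = 1)%E.
Proof.
move=> l01; rewrite -(integral_powR01 (odds_gt0 l01)); apply: eq_integral => t.
by move/set_mem; rewrite /= in_itv/= => t01; rewrite eta_pdfE.
Qed.

Lemma integrable_eta_pdf l : 0 < l < 1 ->
  mu.-integrable `[0, 1] (EFin \o eta_pdf l).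
Proof.
move=> l01; apply/integrableP; split.
  by apply/measurable_EFinP/measurable_funTS; exact: measurable_eta_pdf.
under eq_integral do rewrite /= ger0_norm ?eta_pdf_ge0//.
by rewrite integral_eta_pdf// ltry.
Qed.

Lemma Rintegral_eta_pdf l : 0 < l < 1 -> \int[mu]_(t in `[0, 1]) eta_pdf l t = 1.
Proof. by move=> l01; rewrite /Rintegral integral_eta_pdf. Qed.

(** With [a = odds l], the function [t * a t^(a - 1)] is [a / (a + 1) = l] times the density of
    parameter [a + 1], which has mass 1. *)
Lemma eta_pdf_mean l : 0 < l < 1 ->
  \int[mu]_(t in `[0, 1]) (t * eta_pdf l t) = l.
Proof.
move=> l01; pose a := odds l; have a0 : 0 < a := odds_gt0 l01.
have aS0 : 0 < a + 1 by rewrite addr_gt0.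
transitivity (\int[mu]_(t in `[0, 1]) (l * ((a + 1) * t `^ (a + 1 - 1)))).
  apply: eq_Rintegral => t /set_mem; rewrite /= in_itv/= => t01.
  rewrite eta_pdfE// -/a addrK.
  have lE : l * (a + 1) = a.
    by rewrite /a /odds; field; rewrite subr_eq0 eq_sym lt_eqF//; case/andP: l01.
  rewrite [RHS]mulrA lE mulrCA; congr (_ * _).
  have [->|t0] := eqVneq t 0; first by rewrite mul0r powR0// gt_eqF.
  rewrite -{1}[t]powRr1; last by case/andP: t01.
  by rewrite -powRD ?t0 ?implybT// addrC subrK.
rewrite /Rintegral; under eq_integral do rewrite EFinM.
rewrite ge0_integralZl//; last 3 first.
- apply/measurable_EFinP; apply: measurable_funM => //.
  by apply: measurable_funTS; exact: measurable_powR.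
- by move=> t _; rewrite lee_fin mulr_ge0 ?powR_ge0// ltW.
- by case/andP: l01 => l0 _; rewrite lee_fin ltW.
by rewrite integral_powR01// mule1.
Qed.

(* Scheffe: [|p_n - p| = 2 (p - p_n)^+ - (p - p_n)], where the first term is
   dominated by [p] and the second one integrates to 0. *)
Lemma eta_pdf_cvgL1 l (u : nat -> R) : 0 < l < 1 -> (forall n, 0 < u n < 1) ->
  u n @[n --> \oo] --> l ->
  \int[mu]_(t in `[0, 1]) `|eta_pdf (u n) t - eta_pdf l t| @[n --> \oo] --> (0 : R).
Proof.
move=> l01 u01 ul; pose p := eta_pdf l; pose pn n := eta_pdf (u n).
(* The point 0 is left out because the power of 0 jumps at exponent 0, so pointwise convergence of
   the densities can fail there when [l = 1/2]. *)
pose D : set (measurableTypeR R) := `]0, 1]%classic.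
have mD : measurable D by exact: measurable_itv.
have mpdf k : measurable_fun D (eta_pdf k).
  by apply: measurable_funTS; exact: measurable_eta_pdf.
have DS : D `<=` `[0, 1] by apply: subset_itvr; rewrite bnd_simp.
have iD k : 0 < k < 1 -> mu.-integrable D (EFin \o eta_pdf k).
  by move=> k01; apply: (integrableS _ mD DS (integrable_eta_pdf k01)).
have ID k : 0 < k < 1 -> \int[mu]_(t in D) eta_pdf k t = 1.
  by move=> k01; rewrite Rintegral_itv_obnd_cbnd ?Rintegral_eta_pdf//; exact: iD.
pose g n t : R := Num.max 0 (p t - pn n t).
have mg n : measurable_fun D (g n).
  by apply: measurable_maxr => //; apply: measurable_funB; exact: mpdf.
have g_le n t : `|g n t| <= p t.
  rewrite /g; have := eta_pdf_ge0 l t; have := eta_pdf_ge0 (u n) t.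
  rewrite -/(p t) -/(pn n t) maxEge; case: ifPn => [_ pn0 p0|].
    by rewrite normr0.
  by rewrite -ltNge => ? ? ?; rewrite ger0_norm; lra.
have ig n : mu.-integrable D (EFin \o g n).
  apply: le_integrable (iD _ l01) => //; first exact/measurable_EFinP.
  by move=> t _ /=; rewrite lee_fin (le_trans (g_le _ _))// ler_norm.
have odds_cvg : odds (u n) @[n --> \oo] --> odds l.
  apply: cvgM => //; apply: cvgV.
    by rewrite subr_eq0 eq_sym lt_eqF//; case/andP: l01.
  by apply: cvgB => //; exact: cvg_cst.
have p_cvg t : D t -> pn n t @[n --> \oo] --> p t.
  move=> Dt; have := Dt; rewrite /D/= in_itv/= => /andP[t0 t1].
  have t01 : 0 <= t <= 1 by rewrite (ltW t0).
  rewrite /p eta_pdfE//.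
  rewrite [X in X @ _ --> _](_ : _ =
      fun n => odds (u n) * t `^ (odds (u n) - 1)); last first.
    by apply/funext => n; rewrite /pn eta_pdfE.
  apply: cvgM => //; rewrite /powR gt_eqF//.
  apply: (@continuous_cvg _ _ _ _ _ _ expR); first exact: continuous_expR.
  by apply: cvgM; [apply: cvgB => //|]; exact: cvg_cst.
have g0 : \int[mu]_(t in D) g n t @[n --> \oo] --> (0 : R).
  rewrite [X in _ --> X](_ : 0 = \int[mu]_(t in D) cst 0 t); last first.
    by rewrite Rintegral_cst// mul0r.
  apply: (Rintegral_dominated mD mg) (iD _ l01) _ => // t Dt.
  apply: (@dist_squeeze _ _ (fun n => `|pn n t - p t|)).
    move=> n; rewrite subr0 /g maxEge distrC; case: ifPn => // _.
    by rewrite normr0.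
  rewrite -(normr0 R) -(subrr (p t)); apply: cvg_norm.
  by apply: cvgB; [exact: p_cvg|exact: cvg_cst].
have eqn n : \int[mu]_(t in `[0, 1]) `|eta_pdf (u n) t - eta_pdf l t| =
    2 * \int[mu]_(t in D) g n t.
  have iB : mu.-integrable D (EFin \o (fun t => p t - pn n t)).
    exact: (integrableB mD (iD _ l01) (iD _ (u01 n))).
  have iN : mu.-integrable D (EFin \o (fun t => `|pn n t - p t|)).
    exact/integrable_norm/(integrableB mD (iD _ (u01 n)) (iD _ l01)).
  rewrite -Rintegral_itv_obnd_cbnd//.
  transitivity (\int[mu]_(t in D) (2 * g n t - (p t - pn n t))).
    apply: eq_Rintegral => t _; rewrite /g -/(pn n t) -/(p t) maxEge.
    case: ifPn => [h|]; first by rewrite ger0_norm; lra.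
    by rewrite -ltNge => h; rewrite ltr0_norm; lra.
  have i2 : mu.-integrable D (EFin \o (fun t => 2 * g n t)).
    exact: (integrableZl mD 2 (ig n)).
  rewrite RintegralB// RintegralB//; [|exact: iD|exact: iD].
  by rewrite !ID// subrr subr0 RintegralZl.
rewrite (funext eqn) -(mulr0 2); apply: cvgM => //; exact: cvg_cst.
Qed.

End eta_density.

(** * Convex functions and Jensen's inequality for [eta_l] *)

Section convex_functions.
Context (R : realType) (phi : R -> R).
Hypothesis phi_convex : forall s t u : R, 0 <= s <= 1 -> 0 <= t <= 1 ->
  0 <= u <= 1 -> phi ((1 - s) * t + s * u) <= (1 - s) * phi t + s * phi u.

Lemma convex_three_points (t l u : R) : 0 <= t -> t < l -> l < u -> u <= 1 ->
  phi l * (u - t) <= (u - l) * phi t + (l - t) * phi u.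
Proof.
move=> t0 tl lu u1; have ut : 0 < u - t by lra.
pose s := (l - t) / (u - t).
have s01 : 0 <= s <= 1.
  rewrite /s divr_ge0 ?(ltW ut)//=; last by lra.
  by rewrite ler_pdivrMr// mul1r; lra.
have lE : (1 - s) * t + s * u = l.
  by rewrite /s; field; rewrite gt_eqF.
have t01 : 0 <= t <= 1 by apply/andP; split; lra.
have u01 : 0 <= u <= 1 by apply/andP; split; lra.
have := phi_convex s01 t01 u01; rewrite lE -(ler_pM2r ut).
suff -> : ((1 - s) * phi t + s * phi u) * (u - t) =
  (u - l) * phi t + (l - t) * phi u by [].
by rewrite /s; field; rewrite gt_eqF.
Qed.

(** The slope [k] is the supremum of the chord slopes on the left of [l]; by [convex_three_points]
    every chord slope on the right is an upper bound. *)
Lemma convex_support (l : R) : 0 < l < 1 ->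
  exists k, forall t, 0 <= t <= 1 -> phi l + k * (t - l) <= phi t.
Proof.
move=> /andP[l0 l1]; pose S := [set (phi l - phi t) / (l - t) | t in `[0, l[%classic].
have ubS u : l < u <= 1 -> ubound S ((phi u - phi l) / (u - l)).
  move=> /andP[lu u1] y [t /=]; rewrite in_itv/= => /andP[t0 tl] <- {y}.
  rewrite ler_pdivrMr ?subr_gt0// mulrAC ler_pdivlMr ?subr_gt0//.
  by have := convex_three_points t0 tl lu u1; lra.
have S0 : S !=set0.
  by exists ((phi l - phi 0) / (l - 0)), 0 => //=; rewrite in_itv/= lexx.
have supS : has_sup S.
  by split=> //; exists ((phi 1 - phi l) / (1 - l)); apply: ubS; rewrite l1 lexx.
exists (sup S) => t /andP[t0 t1].
have [tl|lt|->] := ltgtP t l; last by rewrite subrr mulr0 addr0.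
- have : (phi l - phi t) / (l - t) <= sup S.
    apply: sup_upper_bound => //; exists t => //=.
    by rewrite in_itv/= t0 tl.
  by rewrite ler_pdivrMr ?subr_gt0//; lra.
- have : sup S <= (phi t - phi l) / (t - l).
    by apply: ge_sup => //; apply: ubS; rewrite lt t1.
  by rewrite ler_pdivlMr ?subr_gt0//; lra.
Qed.

Local Notation mu := (@lebesgue_measure R).

Hypothesis phi_measurable : measurable_fun (`[0, 1]%classic : set (measurableTypeR R)) phi.
Hypothesis phi_bounded : exists M, forall t, 0 <= t <= 1 -> `|phi t| <= M.

Lemma integrable_mul_eta_pdf (h : R -> R) (l M : R) : 0 < l < 1 ->
  measurable_fun (`[0, 1]%classic : set (measurableTypeR R)) h ->
  (forall t, 0 <= t <= 1 -> `|h t| <= M) ->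
  mu.-integrable `[0, 1] (EFin \o (fun t => h t * eta_pdf l t)).
Proof.
move=> l01 mh hM.
rewrite (_ : EFin \o _ = ((EFin \o eta_pdf l) \* (EFin \o h))%E); last first.
  by apply/funext => t /=; rewrite -EFinM mulrC.
apply: integrableMl => //; first exact: integrable_eta_pdf.
exists M; split; first exact: num_real.
move=> x Mx t /=; rewrite in_itv/= => t01.
by rewrite (le_trans (hM _ t01))// ltW.
Qed.

Lemma affine_eta (c k l : R) : 0 < l < 1 ->
  mu.-integrable `[0, 1] (EFin \o (fun t => (c + k * t) * eta_pdf l t)) /\
  \int[mu]_(t in `[0, 1]) ((c + k * t) * eta_pdf l t) = c + k * l.
Proof.
move=> l01; split.
  apply: (@integrable_mul_eta_pdf _ _ (`|c| + `|k|)) => //.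
    by apply: measurable_funD => //; exact: measurable_funM.
  move=> t /andP[t0 t1]; rewrite (le_trans (ler_normD _ _))// lerD2l.
  by rewrite normrM ler_piMr// ger0_norm.
have it : mu.-integrable `[0, 1] (EFin \o (fun t => t * eta_pdf l t)).
  apply: (@integrable_mul_eta_pdf _ _ 1) => // t /andP[t0 t1].
  by rewrite ger0_norm.
have ip := integrable_eta_pdf l01.
rewrite (@eq_Rintegral _ _ _ mu _ (fun t => c * eta_pdf l t + k * (t * eta_pdf l t))); last first.
  by move=> t _; ring.
have mD : measurable (`[0, 1]%classic : set (measurableTypeR R)) by exact: measurable_itv.
rewrite RintegralD//; [|exact: (integrableZl mD c ip)|exact: (integrableZl mD k it)].
by rewrite !RintegralZl// Rintegral_eta_pdf// eta_pdf_mean// mulr1.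
Qed.

Lemma jensen_eta (l : R) : 0 < l < 1 ->
  phi l <= \int[mu]_(t in `[0, 1]) (phi t * eta_pdf l t) <=
  (1 - l) * phi 0 + l * phi 1.
Proof.
move=> l01; have [k supp] := convex_support l01; have [M phiM] := phi_bounded.
have iphi := integrable_mul_eta_pdf l01 phi_measurable phiM.
have [i1 e1] := affine_eta (phi l - k * l) k l01.
have [i2 e2] := affine_eta (phi 0) (phi 1 - phi 0) l01.
have mD : measurable (`[0, 1]%classic : set (measurableTypeR R)) by exact: measurable_itv.
apply/andP; split.
  rewrite -[leLHS](subrK (k * l)) -e1.
  apply: le_Rintegral => // t /=; rewrite in_itv/= => t01.
  rewrite ler_wpM2r ?eta_pdf_ge0//; have := supp _ t01; lra.
have -> : (1 - l) * phi 0 + l * phi 1 = phi 0 + (phi 1 - phi 0) * l by ring.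
rewrite -e2; apply: le_Rintegral => // t /=; rewrite in_itv/= => t01.
rewrite ler_wpM2r ?eta_pdf_ge0//.
have := phi_convex t01 (t := 0) (u := 1); rewrite !lexx ler01 mulr0 mulr1 add0r.
by move=> /(_ isT isT); lra.
Qed.

End convex_functions.


(** * The operator order through quadratic forms *)

Section loewner_order.
Context (R : realType) (H : hilbertType R).
Implicit Types (X Y : bop H) (x y : H).

Lemma ople_rip X Y : ople X Y -> forall x, rip (X x) x <= rip (Y x) x.
Proof.
move=> XY x; have := XY x; rewrite lecE => /andP[_].
by rewrite -[complex.Re (inner _ _)]/(rip _ _) bopBE ripBl subr_ge0.
Qed.

(** Nonnegativity in [R[i]] includes a zero imaginary part, which self-adjointness supplies. Hence
    the self-adjointness of the integrals has to be established too. *)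
Lemma rip_ople X Y : selfadjoint X -> selfadjoint Y ->
  (forall x, rip (X x) x <= rip (Y x) x) -> ople X Y.
Proof.
move=> sX sY XY x.
have /selfadjointP sYX : selfadjoint (Y - X).
  rewrite -scaleN1r -[-1](rmorphN1 (real_complex R)).
  exact/selfadjointD/selfadjointZ.
rewrite lecE -[complex.Re (inner _ _)]/(rip _ _) bopBE ripBl subr_ge0 XY andbT.
apply/eqP; have : inner ((Y - X) x) x = (inner ((Y - X) x) x)^*.
  by rewrite -inner_conj; have /selfadjointP -> := sYX.
by rewrite bopBE; case: (inner _ _) => u v [] /=; lra.
Qed.

Lemma rip_nabla (s : R) X Y x y :
  rip (nabla s X Y x) y = (1 - s) * rip (X x) y + s * rip (Y x) y.
Proof. by rewrite /nabla bopDE !bopZE ripDl !ripZl. Qed.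

Lemma ople_trivial X Y : (1 : bop H) = 0 -> ople X Y.
Proof.
move=> e x; have -> : x = 0 by rewrite -[x]bop1E e bop0E.
by rewrite bop0 inner_norm normr0 expr0n.
Qed.

End loewner_order.

(** * Integral inequalities for a norm continuous family [F] *)

Section hermite_hadamard.
Context (R : realType) (H : hilbertType R) (F : R -> bop H) (K : R).
Local Notation mu := (@lebesgue_measure R).
Local Notation D := (`[0, 1]%classic : set (measurableTypeR R)).
Local Notation E := (`]0, 1[%classic : set (measurableTypeR R)).
Hypothesis F_bounded : forall t : R, 0 <= t <= 1 -> opnorm (F t) <= K.
Hypothesis F_continuous : forall (u : nat -> R) (t : R), 0 <= t <= 1 ->
  (forall n, 0 <= u n <= 1) -> u n @[n --> \oo] --> t ->
  F (u n) @[n --> \oo] --> F t.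
Implicit Types (x y : H) (l t : R).

Let G l := bochner (eta_measure l) `[0, 1] F.

Let mD : measurable D. Proof. exact: measurable_itv. Qed.
Let mE : measurable E. Proof. exact: measurable_itv. Qed.
Let ED : E `<=` D. Proof. by apply: subset_itvW. Qed.
Let muD : (mu D < +oo)%E.
Proof. by rewrite lebesgue_measure_itv/= lte_fin ltr01 -EFinD ltry. Qed.
Let muE : (mu E < +oo)%E.
Proof. by rewrite lebesgue_measure_itv/= lte_fin ltr01 -EFinD ltry. Qed.

Let K0 : 0 <= K.
Proof. by apply: le_trans (opnorm_ge0 _) (F_bounded (t := 0) _); rewrite lexx ler01. Qed.

Lemma segment_approximable : simply_approximable D F.
Proof.
apply: (@seq_continuous_approximable _ _ D F K) => //.
- move=> t v; rewrite /= !in_itv/= => /andP[t0 t1] /andP[v0 vt].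
  by rewrite (ltW v0)/= (le_trans vt)// ge_max t1 invf_le1// ler1n.
- by move=> t u; rewrite /= in_itv/= => t01 u01 ut; exact: F_continuous.
Qed.

Let aF := segment_approximable.

Lemma rip_eta_bochner l x y : 0 < l < 1 ->
  rip (G l x) y = \int[mu]_(t in D) (rip (F t x) y * eta_pdf l t).
Proof.
move=> l01; rewrite (@bochner_rip _ _ _ _ (eta_measure l) D mD _ F aF).
- apply: (@approximable_density _ _ _ _ mu D mD F aF).
  + exact: integrable_eta_pdf.
  + by move=> t _; exact: eta_pdf_ge0.
  + by [].
- by rewrite [X in (X < _)%E](integral_eta_pdf l01) ltry.
Qed.

Lemma integrable_rip_mul (w : R -> R) x y : mu.-integrable D (EFin \o w) ->
  mu.-integrable D (EFin \o (fun t => rip (F t x) y * w t)).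
Proof.
move=> iw.
rewrite (_ : EFin \o _ = ((EFin \o w) \* (EFin \o (fun t => rip (F t x) y)))%E); last first.
  by apply/funext => t /=; rewrite -EFinM mulrC.
apply: (integrableMl mD iw); first exact: (approximable_measurable_rip aF).
exists (K * (rnorm x * rnorm y)); split; first exact: num_real.
move=> z Kz t; rewrite /= in_itv/= => t01; rewrite (le_trans _ (ltW Kz))//.
rewrite (le_trans (rip_opnorm _ _ _))// ler_wpM2r ?F_bounded//.
by rewrite mulr_ge0 ?rnorm_ge0.
Qed.

(** With [w] a density this bounds [G l] by [K]; with [w] a difference of densities it bounds the
    increments of [G] by an [L^1] distance. *)
Lemma Rintegral_rip_mul_le (w : R -> R) x y : mu.-integrable D (EFin \o w) ->
  `|\int[mu]_(t in D) (rip (F t x) y * w t)| <=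
  K * (\int[mu]_(t in D) `|w t|) * (rnorm x * rnorm y).
Proof.
move=> iw; have irw := integrable_rip_mul x y iw.
have iw' : mu.-integrable D (EFin \o (fun t => `|w t|)) by exact: integrable_norm iw.
rewrite (le_trans (le_normr_Rintegral mD irw))// mulrAC -RintegralZl//.
apply: le_Rintegral => //.
- exact: integrable_norm irw.
- exact: (integrableZl mD _ iw').
- move=> t; rewrite /= in_itv/= => t01; rewrite normrM ler_wpM2r//.
  rewrite (le_trans (rip_opnorm _ _ _))// ler_wpM2r ?F_bounded//.
  by rewrite mulr_ge0 ?rnorm_ge0.
Qed.

Lemma eta_bochner_approximable : simply_approximable E G.
Proof.
have E01 t : E t -> 0 < t < 1 by rewrite /= in_itv.
apply: (@seq_continuous_approximable _ _ E G K) => //.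
- move=> t v; rewrite /= !in_itv/= => /andP[t0 t1] /andP[v0 vt].
  by rewrite v0/= (le_lt_trans vt)// gt_max t1 invf_lt1// ltr1n.
- move=> t /E01 t01; apply: opnorm_rip_le => // x y; rewrite rip_eta_bochner//.
  rewrite (le_trans (Rintegral_rip_mul_le _ _ (integrable_eta_pdf t01)))//.
  rewrite (@eq_Rintegral _ _ _ mu D (eta_pdf t)) ?Rintegral_eta_pdf ?mulr1//.
  by move=> s _; rewrite ger0_norm ?eta_pdf_ge0.
- move=> t u /E01 t01 uE ut; have u01 n := E01 _ (uE n).
  apply: (@rnorm_squeeze _ _ _ _
    (fun n => K * \int[mu]_(s in D) `|eta_pdf (u n) s - eta_pdf t s|)).
    move=> n; apply: opnorm_rip_le => [|x y].
      by rewrite mulr_ge0// Rintegral_ge0.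
    have i1 := integrable_eta_pdf (u01 n); have i2 := integrable_eta_pdf t01.
    have i3 : mu.-integrable D (EFin \o (fun s => eta_pdf (u n) s - eta_pdf t s)).
      exact: (integrableB mD i1 i2).
    have -> : rip ((G (u n) - G t) x) y =
        \int[mu]_(s in D) (rip (F s x) y * eta_pdf (u n) s) -
        \int[mu]_(s in D) (rip (F s x) y * eta_pdf t s).
      exact: (etrans (ripBl _ _ _) (congr2 (fun a b => a - b)
        (rip_eta_bochner x y (u01 n)) (rip_eta_bochner x y t01))).
    rewrite -(RintegralB mD (integrable_rip_mul x y i1) (integrable_rip_mul x y i2)).
    apply: le_trans (Rintegral_rip_mul_le x y i3).
    by under eq_Rintegral do rewrite -mulrBr.
  rewrite -[X in _ --> X](mulr0 K); apply: cvgM; first exact: cvg_cst.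
  exact: (eta_pdf_cvgL1 t01 u01 ut).
Qed.

Let aG := eta_bochner_approximable.

Let J := bochner mu D F.
Let L := bochner mu E G.

Hypothesis F_selfadjoint : forall t : R, 0 <= t <= 1 -> selfadjoint (F t).

Lemma selfadjoint_bochner : selfadjoint J.
Proof.
apply/selfadjointP => x y; rewrite (ripC x) !bochner_rip//.
apply: eq_Rintegral => t /set_mem; rewrite /= in_itv/= => t01.
by have /selfadjointP -> := F_selfadjoint t01; rewrite ripC.
Qed.

Lemma selfadjoint_bochner_eta : selfadjoint L.
Proof.
apply/selfadjointP => x y; rewrite (ripC x) !bochner_rip//.
apply: eq_Rintegral => l /set_mem; rewrite /= in_itv/= => l01.
rewrite !rip_eta_bochner//.
apply: eq_Rintegral => t /set_mem; rewrite /= in_itv/= => t01.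
by have /selfadjointP -> := F_selfadjoint t01; rewrite ripC.
Qed.

Lemma rip_bochner_half x y : rip (J x) y = rip (G 2^-1 x) y.
Proof.
have half01 : 0 < (2^-1 : R) < 1 by apply/andP; split; lra.
apply: (etrans (bochner_rip mD muD aF x y)).
apply: (etrans _ (esym (rip_eta_bochner x y half01))).
apply: eq_Rintegral => t /set_mem; rewrite /= in_itv/= => t01.
rewrite eta_pdfE//; have -> : odds 2^-1 = 1 :> R by rewrite /odds; field.
by rewrite subrr powRr0 !mulr1.
Qed.

(** [J] integrates over the closed interval and [L] over the open one; this allows their integrands
    to be compared pointwise. *)
Lemma Rintegral_oo_cc (h : R -> R) : mu.-integrable D (EFin \o h) ->
  \int[mu]_(t in E) h t = \int[mu]_(t in D) h t.
Proof.
move=> ih; rewrite Rintegral_itv_obnd_cbnd ?Rintegral_itv_bndo_bndc//.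
- apply: integrableS ih => //; apply: subset_itvl; rewrite bnd_simp//.
- by apply: integrableS ih => //.
Qed.

(* [c] is 1 in the convex case and -1 in the concave one. *)
Lemma hermite_hadamard_eta (c : R) x :
  (forall s t u : R, 0 <= s <= 1 -> 0 <= t <= 1 -> 0 <= u <= 1 ->
    c * rip (F ((1 - s) * t + s * u) x) x <=
    (1 - s) * (c * rip (F t x) x) + s * (c * rip (F u x) x)) ->
  [/\ c * rip (F 2^-1 x) x <= c * rip (J x) x,
      c * rip (J x) x <= c * rip (L x) x &
      c * rip (L x) x <= c * rip (nabla 2^-1 (F 0) (F 1) x) x].
Proof.
move=> cvx; pose phi t := c * rip (F t x) x.
have half01 : 0 < (2^-1 : R) < 1 by apply/andP; split; lra.
have mphi : measurable_fun D phi.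
  by apply: measurable_funM => //; exact: (approximable_measurable_rip aF).
have bphi : exists M, forall t, 0 <= t <= 1 -> `|phi t| <= M.
  exists (`|c| * (K * (rnorm x * rnorm x))) => t t01.
  rewrite normrM ler_wpM2l// (le_trans (rip_opnorm _ _ _))//.
  by rewrite ler_wpM2r ?F_bounded// mulr_ge0 ?rnorm_ge0.
have psiE l : 0 < l < 1 ->
    c * rip (G l x) x = \int[mu]_(t in D) (phi t * eta_pdf l t).
  move=> l01; rewrite rip_eta_bochner// -RintegralZl//; last first.
    exact/integrable_rip_mul/integrable_eta_pdf.
  by apply: eq_Rintegral => t _; rewrite mulrA.
have jensen l : 0 < l < 1 -> phi l <= c * rip (G l x) x <=
    phi 0 + (phi 1 - phi 0) * l.
  move=> l01; rewrite psiE//.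
  have /andP[-> /= /le_trans -> //] := @jensen_eta _ phi cvx mphi bphi l l01.
  by rewrite le_eqVlt; apply/orP; left; apply/eqP; ring.
have iF : mu.-integrable D (EFin \o phi).
  exact: (integrableZl mD c (approximable_integrable_rip mD muD aF x x)).
have iFE : mu.-integrable E (EFin \o phi) by exact: integrableS iF.
have iG : mu.-integrable E (EFin \o (fun l => c * rip (G l x) x)).
  exact: (integrableZl mE c (approximable_integrable_rip mE muE aG x x)).
have iaff : mu.-integrable D (EFin \o (fun l => phi 0 + (phi 1 - phi 0) * l)).
  apply: (@le_bounded_integrable _ _ _ _ _ mD muD _ (`|phi 0| + `|phi 1 - phi 0|)).
    by apply: measurable_funD => //; exact: measurable_funM.
  move=> t; rewrite /= in_itv/= => /andP[t0 t1].
  rewrite (le_trans (ler_normD _ _))// lerD2l.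
  by rewrite normrM ler_piMr// ger0_norm.
have LE : c * rip (L x) x = \int[mu]_(l in E) (c * rip (G l x) x).
  rewrite (RintegralZl c mE (approximable_integrable_rip mE muE aG x x)).
  by congr (_ * _); exact: (bochner_rip mE muE aG).
have JE : c * rip (J x) x = \int[mu]_(t in D) phi t.
  rewrite (RintegralZl c mD (approximable_integrable_rip mD muD aF x x)).
  by congr (_ * _); exact: (bochner_rip mD muD aF).
split.
- rewrite [in leRHS]rip_bochner_half.
  by have /andP[] := jensen _ half01.
- rewrite [leRHS]LE [leLHS]JE -Rintegral_oo_cc//; apply: le_Rintegral => // l.
  by rewrite /= in_itv/= => /jensen/andP[].
- rewrite [leLHS]LE [leRHS](_ : _ = phi 0 + (phi 1 - phi 0) * 2^-1); last first.
    by rewrite rip_nabla /phi; field.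
  (* As [eta_pdf] at [1/2] equals 1 on [[0, 1]], the mean formula for [eta_l] also evaluates the
     Lebesgue integral of the chord. *)
  have [_ <-] := affine_eta (phi 0) (phi 1 - phi 0) half01.
  rewrite [leRHS](_ : _ = \int[mu]_(l in E) (phi 0 + (phi 1 - phi 0) * l)).
    apply: le_Rintegral => //; first exact: integrableS iaff.
    by move=> l; rewrite /= in_itv/= => /jensen/andP[].
  rewrite Rintegral_oo_cc//; apply: eq_Rintegral => t /set_mem.
  rewrite /= in_itv/= => t01; rewrite eta_pdfE//.
  have -> : odds 2^-1 = 1 :> R by rewrite /odds; field.
  by rewrite subrr powRr0 !mulr1.
Qed.

End hermite_hadamard.


(** * Application to the functional calculus *)

Section cfc_on_segment.
Context (R : realType) (H : hilbertType R) (I : set R) (f : R -> R).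
Hypotheses (I_itv : is_interval I) (f_cont : {within I, continuous f}).
Context (A B : bop H).
Hypotheses (nt : (1 : bop H) <> 0) (sA : sa_in I A) (sB : sa_in I B).

(** One compact segment inside [I] carries the spectra for all [t], so the bounds are uniform in [t]
    even if [f] is unbounded on [I]. *)
Lemma cfc_nabla_regular : exists K : R,
  [/\ forall t : R, 0 <= t <= 1 -> opnorm (cfc f (nabla t A B)) <= K,
      forall (u : nat -> R) (t : R), 0 <= t <= 1 ->
        (forall n, 0 <= u n <= 1) -> u n @[n --> \oo] --> t ->
        cfc f (nabla (u n) A B) @[n --> \oo] --> cfc f (nabla t A B),
      forall t : R, 0 <= t <= 1 -> selfadjoint (cfc f (nabla t A B)) &
      forall t : R, 0 <= t <= 1 -> sa_in I (nabla t A B)].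
Proof.
have [a [b [abI sab]]] := sa_in_nabla nt I_itv sA sB.
have cf : {within `[a, b], continuous f} by exact: continuous_subspaceW f_cont.
have [M M0 fM] := segment_bounded cf; exists M; split.
- by move=> t t01; exact: (opnorm_cfc (sab _ t01) cf M0 fM).
- move=> u t t01 u01 ut; apply: (cvg_cfc cf) => [n||]; [exact: sab|exact: sab|].
  exact: cvg_nabla.
- by move=> t t01; exact: (selfadjoint_cfc (sab _ t01) cf).
- move=> t t01; have [st spt] := sab _ t01; split=> // z /spt[x /= xab <-].
  by exists x => //; exact: abI.
Qed.

Let F (t : R) := cfc f (nabla t A B).
Let J := bochner lebesgue_measure `[0, 1] F.
Let L := bochner lebesgue_measure `]0, 1[
  (fun l : R => bochner (eta_measure l) `[0, 1] F).

(** Operator convexity is used between two points of the segment from [A] to [B]; [nabla_nabla]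
    turns it into convexity of the quadratic forms in the parameter. *)
Lemma hermite_hadamard_cfc (c : R) :
  (forall x (s t u : R), 0 <= s <= 1 -> sa_in I (nabla t A B) ->
    sa_in I (nabla u A B) ->
    c * rip (cfc f (nabla s (nabla t A B) (nabla u A B)) x) x <=
    c * rip (nabla s (F t) (F u) x) x) ->
  [/\ selfadjoint (F 2^-1) /\ selfadjoint J, selfadjoint L,
      selfadjoint (nabla 2^-1 (F 0) (F 1)) &
  forall x, [/\ c * rip (F 2^-1 x) x <= c * rip (J x) x,
      c * rip (J x) x <= c * rip (L x) x &
      c * rip (L x) x <= c * rip (nabla 2^-1 (F 0) (F 1) x) x]].
Proof.
move=> cvx; have [K [bF cF sF IF]] := cfc_nabla_regular.
split.
- split; first by apply: sF; apply/andP; split; lra.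
  exact: (selfadjoint_bochner bF cF sF).
- exact: (selfadjoint_bochner_eta bF cF sF).
- by apply: selfadjointD; apply: selfadjointZ; apply: sF; rewrite lexx ler01.
move=> x; apply: (hermite_hadamard_eta bF cF) => s t u s01 t01 u01.
rewrite -nabla_nabla (le_trans (cvx x s t u s01 (IF _ t01) (IF _ u01)))//.
by rewrite rip_nabla le_eqVlt; apply/orP; left; apply/eqP; ring.
Qed.

End cfc_on_segment.

Local Close Scope complex_scope.

Theorem corollary2p3 (R : realType) (H : hilbertType R) (I : set R) (f : R -> R)
    (I_itv : is_interval I) (I_neq0 : I !=set0)
    (f_cont : {within I, continuous f}) :
  (operator_convex H I f ->
   forall A B : bop H, sa_in I A -> sa_in I B ->
   [/\ ople (cfc f (nabla 2^-1 A B))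
            (bochner lebesgue_measure `[0, 1] (fun t : R => cfc f (nabla t A B))),
       ople (bochner lebesgue_measure `[0, 1] (fun t : R => cfc f (nabla t A B)))
            (bochner lebesgue_measure `]0, 1[ (fun l : R =>
               bochner (eta_measure l) `[0, 1] (fun t : R => cfc f (nabla t A B)))) &
       ople (bochner lebesgue_measure `]0, 1[ (fun l : R =>
               bochner (eta_measure l) `[0, 1] (fun t : R => cfc f (nabla t A B))))
            (nabla 2^-1 (cfc f A) (cfc f B))]) /\
  (operator_concave H I f ->
   forall A B : bop H, sa_in I A -> sa_in I B ->
   [/\ ople (bochner lebesgue_measure `[0, 1] (fun t : R => cfc f (nabla t A B)))
            (cfc f (nabla 2^-1 A B)),
       ople (bochner lebesgue_measure `]0, 1[ (fun l : R =>
               bochner (eta_measure l) `[0, 1] (fun t : R => cfc f (nabla t A B))))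
            (bochner lebesgue_measure `[0, 1] (fun t : R => cfc f (nabla t A B))) &
       ople (nabla 2^-1 (cfc f A) (cfc f B))
            (bochner lebesgue_measure `]0, 1[ (fun l : R =>
               bochner (eta_measure l) `[0, 1] (fun t : R => cfc f (nabla t A B))))]).
Proof.
(* In the zero space every spectrum is empty and [spectrum_hull] has no end points to offer, but any
   two operators are comparable. *)
have [triv|nt] := pselect ((1 : bop H) = 0).
  by split=> _ A B _ _; split; exact: ople_trivial.
split=> f_conv A B sA sB.
- have [x s t u s01 st su|[s1 s2] s3 s4 key] :=
    hermite_hadamard_cfc I_itv f_cont nt sA sB (c := 1).
    by rewrite ler_pM2l//; exact: ople_rip (f_conv _ _ st su _ s01) x.
  rewrite nabla0 nabla1 in s4 key.
  split.
  + by apply: (rip_ople s1 s2) => x; have [h _ _] := key x; move: h; rewrite ler_pM2l.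
  + by apply: (rip_ople s2 s3) => x; have [_ h _] := key x; move: h; rewrite ler_pM2l.
  + by apply: (rip_ople s3 s4) => x; have [_ _ h] := key x; move: h; rewrite ler_pM2l.
- have [x s t u s01 st su|[s1 s2] s3 s4 key] :=
    hermite_hadamard_cfc I_itv f_cont nt sA sB (c := -1).
    by rewrite ler_nM2l ?ltrN10//; exact: ople_rip (f_conv _ _ st su _ s01) x.
  rewrite nabla0 nabla1 in s4 key.
  split.
  + apply: (rip_ople s2 s1) => x; have [h _ _] := key x; move: h.
    by rewrite ler_nM2l ?ltrN10.
  + apply: (rip_ople s3 s2) => x; have [_ h _] := key x; move: h.
    by rewrite ler_nM2l ?ltrN10.
  + apply: (rip_ople s4 s3) => x; have [_ _ h] := key x; move: h.
    by rewrite ler_nM2l ?ltrN10.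
Qed.
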